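(* Let $\Lambda = kQ/I$ be a Koszul quiver algebra, with $\mathbb{K}$, $f^n_i$, $\varepsilon^n_i$, $c_{pq}(n,i,r)$ and $d$ as in the context. Let $\eta:\mathbb{K}_n\to\Lambda$ be a $\Lambda^e$-module homomorphism such that for some index $0\le i\le t_n$ and some vertex idempotent $e_j$, $\eta(\varepsilon^n_i)=e_j$ and $\eta(\varepsilon^n_l)=0$ for all $l\neq i$. Suppose that for all $0\leq p\leq t_{m-n}$ one has $o(f^{m-n}_p)\neq e_j$ and $t(f^{m-n}_p)\neq e_j$. Then the associated map $\psi_\eta:\mathbb{K}_{m}\to\mathbb{K}_{m-n+1}$ satisfies $$(d\psi_\eta - (-1)^{n-1}\psi_\eta d )(\varepsilon^m_r) = 0 .$$ If there are indices $p'$ such that $o(f^{m-n}_{p'})=e_j$ and $t(f^{m-n}_{p'})=e_j$, the equation $(d\psi_\eta - (-1)^{n-1}\psi_\eta d )(\varepsilon^m_r) = 0$ holds provided $$c_{i,p'}(m,r,n) = (-1)^{n(m-n)} c_{p',i}(m,r,m-n)$$ for these $p'$.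
   Context: $k$ is a field, $\otimes=\otimes_k$ unless indicated, $\Lambda=kQ/I$ is a graded Koszul quiver algebra ($Q$ a finite quiver, $I$ an admissible ideal, paths concatenated left to right), $\Lambda^e=\Lambda\otimes\Lambda^{op}$, and $o(x),t(x)$ denote the origin and terminal vertex (identified with the corresponding idempotents) of a uniform element $x$, i.e. a nonzero linear combination of paths with common origin and common terminus. Put $R=kQ$. There are integers $t_n$ and uniform elements $\{f^n_i\}_{i=0}^{t_n}\subset R$, $n\ge 0$ ($f^0_i$ the vertices, $f^1_i$ the arrows, $f^2_i$ uniform relations generating $I$), with $\cdots\subseteq\bigoplus_i f^n_iR\subseteq\bigoplus_i f^{n-1}_iR\subseteq\cdots\subseteq R$, such that $\mathbb{L}_n=\bigoplus_i f^n_iR/\bigoplus_i f^n_iI$ with differentials induced by the inclusions is a minimal projective resolution of $\Lambda_0$ as a right $\Lambda$-module, and there are scalars $c_{pq}(n,i,r)$ (also written $c_{p,q}(n,i,r)$) with $$f^n_i=\sum_{p=0}^{t_r}\sum_{q=0}^{t_{n-r}}c_{pq}(n,i,r)f^r_pf^{n-r}_q\qquad(0\le r\le n).$$ These are fixed. The minimal projective $\Lambda^e$-resolution $\mathbb{K}\to\Lambda$ is $\mathbb{K}_n=\bigoplus_{i=0}^{t_n}\Lambda o(f^n_i)\otimes_k t(f^n_i)\Lambda$, with generators $\varepsilon^n_i=(0,\dots,0,o(f^n_i)\otimes_k t(f^n_i),0,\dots,0)$ ($i$-th position), and $$d_n(\varepsilon^n_i)=\sum_{j=0}^{t_{n-1}}\Big(\sum_{p=0}^{t_1}c_{p,j}(n,i,1)f^1_p\varepsilon^{n-1}_j+(-1)^n\sum_{q=0}^{t_1}c_{j,q}(n,i,n-1)\varepsilon^{n-1}_jf^1_q\Big),$$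 where $f^1_p$ also denotes its residue class in $\Lambda$; the augmentation $\mu=d_0:\mathbb{K}_0\to\Lambda$ is multiplication. The diagonal map is $$\Delta_{\mathbb{K}}(\varepsilon^n_r)=\sum_{v=0}^n\sum_{p=0}^{t_v}\sum_{q=0}^{t_{n-v}}c_{p,q}(n,r,v)\,\varepsilon^v_p\otimes_\Lambda\varepsilon^{n-v}_q .$$ For $\eta:\mathbb{K}_n\to\Lambda$ (extended by zero to other degrees), $\eta\otimes1$ and $1\otimes\eta$ are the maps $\mathbb{K}\otimes_\Lambda\mathbb{K}\to\mathbb{K}$ given by $(\eta\otimes 1)(x\otimes y)=\eta(x)y$ and $(1\otimes\eta)(x\otimes y)=(-1)^{n|x|}x\,\eta(y)$. The associated map $\psi_\eta$ of $\eta$ is a $\Lambda^e$-module map $\psi_\eta:\mathbb{K}\to\mathbb{K}[1-n]$ (i.e. $\mathbb{K}_m\to\mathbb{K}_{m-n+1}$) with $d\psi_\eta-(-1)^{n-1}\psi_\eta d=(\eta\otimes1-1\otimes\eta)\Delta_{\mathbb{K}}$. *)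

(* Defs.v *)
From HB Require Import structures.
From mathcomp Require Import all_boot all_order all_algebra all_field.
From mathcomp Require Import finmap.
From mathcomp.multinomials Require Import monalg.

Set Implicit Arguments.
Unset Strict Implicit.
Unset Printing Implicit Defensive.

Import GRing.Theory.
Import VectorInternalTheory.

Local Open Scope ring_scope.

(** * Path algebras *)

Record quiver := Quiver {
  vert : finType;
  arrow : finType;
  src : arrow -> vert;
  tgt : arrow -> vert }.

(* [(v, s)] is the path which starts at [v] and follows the arrows of [s] from
   left to right; [(v, [::])] is the trivial path at [v]. *)
Fixpoint is_qpath (Q : quiver) (v : vert Q) (s : seq (arrow Q)) : bool :=
  if s is a :: s' then (src a == v) && is_qpath (tgt a) s' else true.

Record qpath (Q : quiver) := QPath {
  qpath_val :> vert Q * seq (arrow Q);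
  _ : is_qpath qpath_val.1 qpath_val.2 }.

HB.instance Definition _ (Q : quiver) := [isSub for @qpath_val Q].
HB.instance Definition _ (Q : quiver) := [Choice of qpath Q by <:].

Definition porig (Q : quiver) (p : qpath Q) : vert Q := p.1.
Definition pterm (Q : quiver) (p : qpath Q) : vert Q :=
  last p.1 (map (@tgt Q) p.2).
Definition plen (Q : quiver) (p : qpath Q) : nat := size p.2.

Definition trivial_path (Q : quiver) (v : vert Q) : qpath Q :=
  @QPath Q (v, [::]) isT.

Lemma arrow_path_subproof (Q : quiver) (a : arrow Q) :
  is_qpath (src a) [:: a].
Proof. by rewrite /= eqxx. Qed.

Definition arrow_path (Q : quiver) (a : arrow Q) : qpath Q :=
  @QPath Q (src a, [:: a]) (arrow_path_subproof a).

Lemma is_qpath_cat (Q : quiver) (v : vert Q) (s1 s2 : seq (arrow Q)) :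
  is_qpath v (s1 ++ s2) =
    is_qpath v s1 && is_qpath (last v (map (@tgt Q) s1)) s2.
Proof. by elim: s1 v => //= a s1 IH v; rewrite IH andbA. Qed.

(* [None] stands for the zero product of two paths that do not compose. *)
Definition pmul (Q : quiver) (p q : qpath Q) : option (qpath Q) :=
  if pterm p == porig q then insub (p.1, p.2 ++ q.2) else None.

Lemma pmul_trivl (Q : quiver) (v : vert Q) (p : qpath Q) :
  pmul (trivial_path v) p = if v == porig p then Some p else None.
Proof.
rewrite /pmul /pterm /=; case: eqP => // ->.
by rewrite /porig -surjective_pairing valK.
Qed.

Lemma pmul_trivr (Q : quiver) (p : qpath Q) (v : vert Q) :
  pmul p (trivial_path v) = if v == pterm p then Some p else None.
Proof.
rewrite /pmul eq_sym /=; case: eqP => // _.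
by rewrite cats0 -surjective_pairing valK.
Qed.

Lemma pmulP (Q : quiver) (p q : qpath Q) : pterm p = porig q ->
  exists2 r, pmul p q = Some r & r = (p.1, p.2 ++ q.2) :> _ * _.
Proof.
move=> e; rewrite /pmul e eqxx.
have pqP : is_qpath (p.1, p.2 ++ q.2).1 (p.1, p.2 ++ q.2).2.
  rewrite /= is_qpath_cat (valP p) /=.
  by move: e; rewrite /pterm /porig => ->; exact: (valP q).
by exists (QPath pqP) => //; rewrite insubT.
Qed.

Section PathMul.
Context (k : fieldType) (Q : quiver) (A : lmodType k) (b : qpath Q -> A).
Implicit Types (x y z : A) (p q r : qpath Q).

Definition ob (o : option (qpath Q)) : A := if o is Some p then b p else 0.

Lemma path_mul_laws (mul : A -> A -> A) :
  (forall P : A -> Prop, P 0 -> (forall x y, P x -> P y -> P (x + y)) ->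
     (forall c p, P (c *: b p)) -> forall x, P x) ->
  left_distributive mul +%R -> right_distributive mul +%R ->
  (forall c x y, mul (c *: x) y = c *: mul x y) ->
  (forall c x y, mul x (c *: y) = c *: mul x y) ->
  (forall p q, mul (b p) (b q) = ob (pmul p q)) ->
  [/\ associative mul, left_id (\sum_v b (trivial_path v)) mul
    & right_id (\sum_v b (trivial_path v)) mul].
Proof.
move=> ind mDl mDr mZl mZr mb.
have m0l y : mul 0 y = 0 by rewrite -(scale0r (0 : A)) mZl !scale0r.
have m0r x : mul x 0 = 0 by rewrite -(scale0r (0 : A)) mZr !scale0r.
have mA_b p q r : mul (b p) (ob (pmul q r)) = mul (ob (pmul p q)) (b r).
  have [pq|npq] := eqVneq (pterm p) (porig q); last first.
    rewrite [pmul p q]/pmul (negPf npq) m0l.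
    have [qr|nqr] := eqVneq (pterm q) (porig r); last first.
      by rewrite /pmul (negPf nqr) m0r.
    have [s -> sE] := pmulP qr; rewrite mb /pmul /porig sE /=.
    by rewrite (negPf npq).
  have [t tE tv] := pmulP pq; rewrite tE mb.
  have te : pterm t = pterm q.
    by move: pq; rewrite /pterm /porig tv /= map_cat last_cat => ->.
  have [qr|nqr] := eqVneq (pterm q) (porig r); last first.
    by rewrite /pmul te (negPf nqr) m0r.
  have [s -> sv] := pmulP qr; rewrite mb; congr ob.
  have ps : pterm p = porig s by rewrite /porig sv.
  have tr : pterm t = porig r by rewrite te.
  have [u -> uv] := pmulP ps; have [w -> wv] := pmulP tr.
  by congr Some; apply: val_inj; rewrite /= uv wv sv tv /= catA.
have msuml I (s : seq I) (P : pred I) (F : I -> A) y :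
    mul (\sum_(i <- s | P i) F i) y = \sum_(i <- s | P i) mul (F i) y.
  exact: (big_morph (mul^~ y) (fun a b => mDl a b y) (m0l y)).
have msumr I (s : seq I) (P : pred I) (F : I -> A) x :
    mul x (\sum_(i <- s | P i) F i) = \sum_(i <- s | P i) mul x (F i).
  exact: (big_morph (mul x) (mDr x) (m0r x)).
split.
- move=> x y z; elim/ind: x => [|x x' IH IH'|a p].
  + by rewrite !m0l.
  + by rewrite !mDl IH IH'.
  rewrite !mZl; congr (_ *: _); elim/ind: y => [|y y' IH IH'|c q].
  + by rewrite m0l m0r m0l.
  + by rewrite mDl !mDr IH IH' mDl.
  rewrite mZl 2!mZr mZl; congr (_ *: _); elim/ind: z => [|z z' IH IH'|d r].
  + by rewrite !m0r.
  + by rewrite !mDr IH IH'.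
  by rewrite !mZr !mb mA_b.
- elim/ind => [|x y IH IH'|c p]; first exact: m0r.
    by rewrite mDr IH IH'.
  rewrite mZr; congr (_ *: _).
  rewrite msuml (bigD1 (porig p)) //= mb pmul_trivl eqxx.
  rewrite big1 ?addr0 // => v /negPf nv.
  by rewrite mb pmul_trivl nv.
elim/ind => [|x y IH IH'|c p]; first exact: m0l.
  by rewrite mDl IH IH'.
rewrite mZl; congr (_ *: _).
rewrite msumr (bigD1 (pterm p)) //= mb pmul_trivr eqxx.
rewrite big1 ?addr0 // => v /negPf nv.
by rewrite mb pmul_trivr nv.
Qed.

End PathMul.

Section PathAlgebra.
Context (k : fieldType) (Q : quiver).

Local Notation kQ := {malg k[qpath Q]}.

Implicit Types (x y z : kQ) (p q r : qpath Q).

Definition bpath p : kQ := << 1 *g p >>.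

Definition pa_one : kQ := \sum_(v : vert Q) bpath (trivial_path v).

Definition pa_mul_def x y : kQ :=
  \sum_(p <- msupp x) \sum_(q <- msupp y) (x@_p * y@_q) *: ob bpath (pmul p q).
Fact pa_mul_key : unit. Proof. by []. Qed.
Definition pa_mul := locked_with pa_mul_key pa_mul_def.
Canonical pa_mul_unlockable := [unlockable fun pa_mul].

Lemma bpathZ_coef c p q : (c *: bpath p)@_q = c *+ (p == q).
Proof. by rewrite mcoeffZ mcoeffU mulrnAr mulr1. Qed.

Lemma bpathE x : x = \sum_(p <- msupp x) x@_p *: bpath p.
Proof.
rewrite {1}[x]monalgE; apply: eq_bigr => p _; apply/malgP => q.
by rewrite bpathZ_coef; exact: mcoeffU.
Qed.

Lemma pa_mulw (d1 d2 : {fset qpath Q}) x y :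
  (msupp x `<=` d1)%fset -> (msupp y `<=` d2)%fset ->
  pa_mul x y =
    \sum_(p <- d1) \sum_(q <- d2) (x@_p * y@_q) *: ob bpath (pmul p q).
Proof.
move=> le1 le2; rewrite unlock (big_fset_incl _ le1) /=; last first.
  by move=> p _ /mcoeff_outdom->; rewrite big1// => q _; rewrite mul0r scale0r.
apply: eq_bigr => p _; apply: (big_fset_incl _ le2) => q _ /mcoeff_outdom->.
by rewrite mulr0 scale0r.
Qed.

Lemma pa_mulDl : left_distributive pa_mul +%R.
Proof.
move=> x y z; set d := (msupp x `|` msupp y)%fset.
rewrite (@pa_mulw d (msupp z) (x + y)) ?fsubset_refl ?msuppD_le //.
rewrite (@pa_mulw d (msupp z) x) ?fsubset_refl ?fsubsetUl //.
rewrite (@pa_mulw d (msupp z) y) ?fsubset_refl ?fsubsetUr //.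
rewrite -big_split /=; apply: eq_bigr => p _.
rewrite -big_split /=; apply: eq_bigr => q _.
by rewrite mcoeffD mulrDl scalerDl.
Qed.

Lemma pa_mulDr : right_distributive pa_mul +%R.
Proof.
move=> z x y; set d := (msupp x `|` msupp y)%fset.
rewrite (@pa_mulw (msupp z) d z (x + y)) ?fsubset_refl ?msuppD_le //.
rewrite (@pa_mulw (msupp z) d z x) ?fsubset_refl ?fsubsetUl //.
rewrite (@pa_mulw (msupp z) d z y) ?fsubset_refl ?fsubsetUr //.
rewrite -big_split /=; apply: eq_bigr => p _.
rewrite -big_split /=; apply: eq_bigr => q _.
by rewrite mcoeffD mulrDr scalerDl.
Qed.

Lemma pa_mulZl c x y : pa_mul (c *: x) y = c *: pa_mul x y.
Proof.
rewrite (@pa_mulw (msupp x) (msupp y)) ?fsubset_refl ?msuppZ_le //.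
rewrite (pa_mulw (fsubset_refl _) (fsubset_refl _)) scaler_sumr; apply: eq_bigr => p _.
rewrite scaler_sumr; apply: eq_bigr => q _.
by rewrite mcoeffZ -mulrA scalerA.
Qed.

Lemma pa_mulZr c x y : pa_mul x (c *: y) = c *: pa_mul x y.
Proof.
rewrite (@pa_mulw (msupp x) (msupp y)) ?fsubset_refl ?msuppZ_le //.
rewrite (pa_mulw (fsubset_refl _) (fsubset_refl _)) scaler_sumr; apply: eq_bigr => p _.
rewrite scaler_sumr; apply: eq_bigr => q _.
by rewrite mcoeffZ mulrCA scalerA.
Qed.

Lemma pa_mul_bpath p q : pa_mul (bpath p) (bpath q) = ob bpath (pmul p q).
Proof.
rewrite (@pa_mulw [fset p]%fset [fset q]%fset) ?msuppU_le //.
by rewrite !big_seq_fset1 !mcoeffUU mulr1 scale1r.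
Qed.

Lemma bpath_ind (P : kQ -> Prop) :
  P 0 -> (forall x y, P x -> P y -> P (x + y)) ->
  (forall c p, P (c *: bpath p)) -> forall x, P x.
Proof. by move=> P0 PD Pb x; rewrite [x]bpathE; apply: big_ind. Qed.

Lemma pa_mul_laws :
  [/\ associative pa_mul, left_id pa_one pa_mul & right_id pa_one pa_mul].
Proof.
exact: (path_mul_laws bpath_ind pa_mulDl pa_mulDr pa_mulZl pa_mulZr
  pa_mul_bpath).
Qed.

Definition pa_mulA : associative pa_mul :=
  let: And3 mA _ _ := pa_mul_laws in mA.
Definition pa_mul1l : left_id pa_one pa_mul :=
  let: And3 _ m1l _ := pa_mul_laws in m1l.
Definition pa_mul1r : right_id pa_one pa_mul :=
  let: And3 _ _ m1r := pa_mul_laws in m1r.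

Definition pathalg : Type := kQ.
HB.instance Definition _ := GRing.Lmodule.on pathalg.
HB.instance Definition _ := GRing.Zmodule_isPzRing.Build pathalg
  pa_mulA pa_mul1l pa_mul1r pa_mulDl pa_mulDr.

End PathAlgebra.

Section Ideals.
Context (k : fieldType) (Q : quiver).
Local Notation kQ := (pathalg k Q).
Implicit Types (x y z : kQ) (p : qpath Q).

Definition vtx (v : vert Q) : kQ := bpath k (trivial_path v).
Definition arr (a : arrow Q) : kQ := bpath k (arrow_path a).

Definition uniform (u v : vert Q) x :=
  x <> 0 /\ forall p, p \in msupp x -> porig p = u /\ pterm p = v.

Definition homog (d : nat) x := forall p, p \in msupp x -> plen p = d.

(* The component of [x] in length [d]. *)
Definition hcomp (d : nat) x : kQ :=
  \sum_(p <- msupp x | plen p == d) x@_p *: (bpath k p : kQ).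

(* Membership in the [d]-th power of the arrow ideal. *)
Definition arrow_pow (d : nat) x :=
  forall p, p \in msupp x -> (d <= plen p)%N.

Definition two_sided_ideal (I : kQ -> Prop) :=
  [/\ I 0, (forall x y, I x -> I y -> I (x + y)) &
      (forall x y z, I y -> I (x * y * z))].

Definition admissible (I : kQ -> Prop) :=
  [/\ two_sided_ideal I,
      (forall x, I x -> arrow_pow 2 x) &
      exists2 d, (2 <= d)%N & forall x, arrow_pow d x -> I x].

Definition graded_ideal (I : kQ -> Prop) :=
  forall d x, I x -> I (hcomp d x).

Definition generates (I S : kQ -> Prop) :=
  forall x, I x <->
    forall I', two_sided_ideal I' -> (forall y, S y -> I' y) -> I' x.

End Ideals.

Arguments vtx {k Q} v.
Arguments arr {k Q} a.

(** * Koszul algebras *)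

Section Koszul.
Context (k : fieldType) (Q : quiver) (Lam : falgType k).
Context (phi : {linear pathalg k Q -> Lam}).

(* [Lam] is the quotient [kQ/I], with projection [phi]. *)
Definition is_quotient (I : pathalg k Q -> Prop) :=
  [/\ monoid_morphism phi, (forall y, exists x, phi x = y) &
      (forall x, phi x = 0 <-> I x)].

Definition gr (d : nat) (y : Lam) := exists2 x, homog d x & phi x = y.
Definition gr_pos (y : Lam) := exists2 x, arrow_pow 1 x & phi x = y.

(* A graded projective right module generated in degree [n] is
   [\bigoplus_(i < b n) e_(v n i) Lam], shifted by [n]; its elements are the
   column vectors satisfying [in_proj]. A degree 0 map between consecutive
   modules is given by a matrix with entries in [e Lam_1 e'], and a degree 0
   map to [Lam_0 = Lam / Lam_+] by a row with entries in [Lam_0 e]. *)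
Definition in_proj (b : nat) (v : 'I_b -> vert Q) (x : 'cV[Lam]_b) :=
  forall i, phi (vtx (v i)) * x i 0 = x i 0.

Definition linear_resolution (b : nat -> nat) (v : forall n, 'I_(b n) -> vert Q)
    (aug : 'rV[Lam]_(b 0)) (D : forall n, 'M[Lam]_(b n, b n.+1)) :=
  [/\ (forall i, gr 0 (aug 0 i) /\ aug 0 i * phi (vtx (v 0%N i)) = aug 0 i),
      (forall n i j, gr 1 (D n i j) /\
        phi (vtx (v n i)) * D n i j * phi (vtx (v n.+1 j)) = D n i j),
      (forall y, exists2 x, in_proj (v 0%N) x & gr_pos (y - (aug *m x) 0 0)),
      (forall x, in_proj (v 0%N) x ->
        gr_pos ((aug *m x) 0 0) <->
        exists2 z, in_proj (v 1%N) z & x = D 0%N *m z) &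
      (forall n x, in_proj (v n.+1) x ->
        D n *m x = 0 <->
        exists2 z, in_proj (v n.+2) z & x = D n.+1 *m z)].

Definition koszul :=
  graded_ideal (fun x => phi x = 0) /\
  exists b v aug D, @linear_resolution b v aug D.

End Koszul.

(** * The elements [f^n_i] and the resolution they define *)

(* [nf n] is the number [t_n + 1] of elements [f^n_i], so that a vanishing term
   of the resolution ([t_n = -1]) is allowed; [cf p q n i r] is
   [c_{pq}(n,i,r)]. The values of [fn], [fo], [ft], [cf] at indices out of range
   play no role. *)
Record resdata (k : fieldType) (Q : quiver) := ResData {
  nf : nat -> nat;
  fn : nat -> nat -> pathalg k Q;
  fo : nat -> nat -> vert Q;
  ft : nat -> nat -> vert Q;
  cf : nat -> nat -> nat -> nat -> nat -> k }.

Section MinimalResolution.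
Context (k : fieldType) (Q : quiver) (I : pathalg k Q -> Prop).
Context (F : resdata k Q).

(* [\sum_i f^n_i S] *)
Definition fspan (n : nat) (S : pathalg k Q -> Prop) (x : pathalg k Q) :=
  exists2 r : nat -> pathalg k Q,
    (forall i, S (r i)) & x = \sum_(i < nf F n) fn F n i * r i.

Local Notation full := (fun _ : pathalg k Q => True).

(* [L_n] is the subquotient [fspan n full / fspan n I] of [kQ], and its
   differential is induced by the inclusions. A summand [f^n_i R / f^n_i I] is
   isomorphic to [t(f^n_i) Lam] because [f^n_i] is uniform, so [L_n] is
   projective. *)
Record minimal_resolution : Prop := MinimalResolution {
  res_uniform : forall n i, (i < nf F n)%N ->
    uniform (fo F n i) (ft F n i) (fn F n i);
  res_vertices :
    perm_eq [seq fn F 0 i | i <- iota 0 (nf F 0)] [seq vtx v | v : vert Q];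
  res_arrows :
    perm_eq [seq fn F 1 i | i <- iota 0 (nf F 1)] [seq arr a | a : arrow Q];
  res_relations :
    generates I (fun x => exists2 i, (i < nf F 2)%N & x = fn F 2 i);
  res_direct : forall n (r : nat -> pathalg k Q),
    \sum_(i < nf F n) fn F n i * r i = 0 ->
    forall i, (i < nf F n)%N -> fn F n i * r i = 0;
  res_nested : forall n x, fspan n.+1 full x -> fspan n full x;
  (* the kernel of [L_0 = kQ/I -> Lam_0] is the image of [L_1] *)
  res_exact0 : forall x,
    arrow_pow 1 x <-> exists y z, [/\ fspan 1 full y, fspan 0 I z & x = y + z];
  (* the kernel of [L_(n+1) -> L_n] is the image of [L_(n+2)] *)
  res_exact : forall n x,
    (fspan n.+1 full x /\ fspan n I x) <->
    exists y z, [/\ fspan n.+2 full y, fspan n.+1 I z & x = y + z];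
  (* the image of [L_(n+1)] lies in the radical of [L_n] *)
  res_minimal : forall n x, fspan n.+1 full x -> fspan n (arrow_pow 1) x }.

Definition structure_constants :=
  forall n i r, (i < nf F n)%N -> (r <= n)%N ->
    fn F n i = \sum_(p < nf F r) \sum_(q < nf F (n - r))
                cf F p q n i r *: (fn F r p * fn F (n - r) q).

End MinimalResolution.

(** * Bimodules *)

Lemma linear_comb (k : fieldType) (U W : lmodType k) (g : U -> W) :
  linear g -> forall (I : finType) (c : I -> k) (a : I -> U),
  g (\sum_i c i *: a i) = \sum_i c i *: g (a i).
Proof.
move=> gl I c a.
have g0 : g 0 = 0.
  by have := gl (-1) 0 0; rewrite scaler0 addr0 scaleN1r addNr.
by elim/big_rec2: _ => // i y1 y2 _ <-; exact: gl.
Qed.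

(* The tensor product of finite dimensional spaces, in coordinates. *)
Section Tensor.
Context (k : fieldType).
Implicit Types U V W : vectType k.

Definition tensor U V : vectType k := 'M[k]_(dim U, dim V).

Definition tens U V (u : U) (v : V) : tensor U V := (v2r u)^T *m v2r v.

Definition tmap_fun U V U' V' (g : 'Hom(U, U')) (h : 'Hom(V, V'))
  (X : tensor U V) : tensor U' V' := (f2mx g)^T *m (X : 'M_(_, _)) *m f2mx h.

Lemma tmap_is_linear U V U' V' (g : 'Hom(U, U')) (h : 'Hom(V, V')) :
  linear (tmap_fun g h).
Proof.
move=> a X Y.
by rewrite /tmap_fun mulmxDr mulmxDl -scalemxAr -scalemxAl.
Qed.

HB.instance Definition _ U V U' V' (g : 'Hom(U, U')) (h : 'Hom(V, V')) :=
  GRing.isLinear.Build k (tensor U V) (tensor U' V') *:%R (tmap_fun g h)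
    (tmap_is_linear g h).

Definition tmap U V U' V' (g : 'Hom(U, U')) (h : 'Hom(V, V')) :
  'Hom(tensor U V, tensor U' V') := linfun (tmap_fun g h).

Lemma v2r_lfun U V (g : 'Hom(U, V)) u : v2r (g u) = v2r u *m f2mx g.
Proof. by rewrite unlock /= r2vK. Qed.

Lemma tmap_tens U V U' V' (g : 'Hom(U, U')) (h : 'Hom(V, V')) u v :
  tmap g h (tens u v) = tens (g u) (h v).
Proof. by rewrite lfunE /= /tmap_fun /tens !v2r_lfun trmx_mul !mulmxA. Qed.

Lemma tens_linearl U V (v : V) : linear (fun u : U => tens u v).
Proof.
by move=> a u u'; rewrite /tens linearP /= linearP /= mulmxDl -scalemxAl.
Qed.

Lemma tens_linearr U V (u : U) : linear (fun v : V => tens u v).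
Proof. by move=> a v v'; rewrite /tens linearP mulmxDr -scalemxAr. Qed.

Definition bvec U (s : 'I_(dim U)) : U := r2v (delta_mx 0 s).

Lemma bvecE U (u : U) : u = \sum_s v2r u 0 s *: bvec s.
Proof.
rewrite -[LHS]v2rK [X in r2v X]row_sum_delta linear_sum /=.
by apply: eq_bigr => s _; rewrite linearZ.
Qed.

Lemma tensorE U V (X : tensor U V) :
  X = \sum_s \sum_t (X : 'M_(_, _)) s t *: tens (bvec s) (bvec t).
Proof.
rewrite [LHS](matrix_sum_delta X); apply: eq_bigr => s _; apply: eq_bigr => t _.
congr (_ *: _); rewrite /tens /bvec !r2vK.
by rewrite trmx_delta mul_delta_mx.
Qed.

Lemma tensor_ext U V W (g h : 'Hom(tensor U V, W)) :
  (forall u v, g (tens u v) = h (tens u v)) -> g = h.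
Proof.
move=> gh; apply/lfunP => X; rewrite [X]tensorE !linear_sum /=.
apply: eq_bigr => s _; rewrite !linear_sum /=; apply: eq_bigr => t _.
by rewrite !linearZ /= gh.
Qed.

End Tensor.

(* Modules over [Lam^e = Lam \otimes Lam^op]; [lact a x] is [a x] and
   [ract a x] is [x a]. *)
Record bimod (k : fieldType) (Lam : falgType k) := Bimod {
  bcar :> vectType k;
  lact : Lam -> 'End(bcar);
  ract : Lam -> 'End(bcar);
  lact_linear : linear lact;
  ract_linear : linear ract;
  lact1 : forall x, lact 1 x = x;
  ract1 : forall x, ract 1 x = x;
  lactM : forall a b x, lact (a * b) x = lact a (lact b x);
  ractM : forall a b x, ract (a * b) x = ract b (ract a x);
  lractC : forall a b x, lact a (ract b x) = ract b (lact a x) }.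

Arguments lact {k Lam _} _.
Arguments ract {k Lam _} _.

Section BimodTheory.
Context (k : fieldType) (Lam : falgType k).
Implicit Types M N : bimod Lam.

Program Definition regular_bimod : bimod Lam :=
  @Bimod k Lam Lam (@amull k Lam) (@amulr k Lam) _ _ _ _ _ _ _.
Next Obligation. exact: linearP. Qed.
Next Obligation. exact: linearP. Qed.
Next Obligation. by rewrite lfunE /= mul1r. Qed.
Next Obligation. by rewrite lfunE /= mulr1. Qed.
Next Obligation. by rewrite !lfunE /= mulrA. Qed.
Next Obligation. by rewrite !lfunE /= mulrA. Qed.
Next Obligation. by rewrite !lfunE /= mulrA. Qed.

Definition bimod_hom M N (g : 'Hom(M, N)) :=
  forall a x, g (lact a x) = lact a (g x) /\ g (ract a x) = ract a (g x).

(** ** The tensor product over [Lam] *)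

Definition bal_map M N (a : Lam) : 'End(tensor M N) :=
  tmap (ract a) \1%VF - tmap \1%VF (lact a).

(* The span of the [x a \otimes y - x \otimes a y]. *)
Definition bal M N : {vspace tensor M N} :=
  (\sum_(s < dim Lam) limg (bal_map M N (bvec s)))%VS.

(* The quotient of [tensor M N] by [bal M N], realised on a complement. *)
Definition btens_car M N : vectType k := subvs_of (bal M N)^C.

Definition bcls M N : 'Hom(tensor M N, btens_car M N) :=
  (linfun (vsproj (bal M N)^C) \o daddv_pi (bal M N)^C (bal M N))%VF.

Definition btens M N (x : M) (y : N) : btens_car M N := bcls M N (tens x y).

Lemma bal_mapE M N a x y :
  bal_map M N a (tens x y) = tens (ract a x) y - tens x (lact a y).
Proof. by rewrite add_lfunE opp_lfunE !tmap_tens !id_lfunE. Qed.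

Lemma bal_map_linear M N : linear (@bal_map M N).
Proof.
move=> c a b; apply: tensor_ext => x y.
rewrite bal_mapE add_lfunE scale_lfunE !bal_mapE.
have := tens_linearl y c (ract a x) (ract b x).
have := tens_linearr x c (lact a y) (lact b y).
rewrite ract_linear lact_linear !add_lfunE !scale_lfunE => -> ->.
by rewrite scalerBr opprD addrACA.
Qed.

Lemma bal_mapP M N a X : bal_map M N a X \in bal M N.
Proof.
rewrite [a]bvecE (linear_comb (@bal_map_linear M N)) sum_lfunE.
rewrite memv_suml // => s _; rewrite scale_lfunE memvZ //.
by apply: subvP (memv_img _ (memvf X)); rewrite (sumv_sup s).
Qed.

Lemma bcls_eq0 M N X : (bcls M N X == 0) = (X \in bal M N).
Proof.
have d : ((bal M N)^C :&: bal M N = 0)%VS by rewrite capvC capv_compl.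
have e := daddv_pi_add d (_ : X \in ((bal M N)^C + bal M N)%VS).
rewrite addvC addv_complf memvf in e; have {}e := e isT.
have bE : vsval (bcls M N X) = daddv_pi (bal M N)^C (bal M N) X.
  by rewrite comp_lfunE lfunE /= vsprojK ?memv_pi.
apply/eqP/idP => [e0 | Xb].
  by rewrite -e -bE e0 linear0 add0r memv_pi.
have XC : daddv_pi (bal M N) (bal M N)^C X = X.
  by apply: daddv_pi_id => //; rewrite capv_compl.
apply: subvs_inj; rewrite bE linear0.
by move: e; rewrite XC => /eqP; rewrite -subr_eq0 addrK => /eqP.
Qed.

Lemma bcls_val M N (Z : btens_car M N) : bcls M N (vsval Z) = Z.
Proof.
rewrite comp_lfunE lfunE /= daddv_pi_id ?vsvalK ?subvsP //.
by rewrite capvC capv_compl.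
Qed.

Lemma btens_balanced M N a (x : M) (y : N) :
  btens (ract a x) y = btens x (lact a y).
Proof.
apply/eqP; rewrite -subr_eq0 /btens -linearB /= bcls_eq0 -bal_mapE.
exact: bal_mapP.
Qed.

(* A map on representatives which is constant on classes factors through the
   quotient, see [bfactorE]. *)
Definition bfactor M N (W : vectType k) (g : 'Hom(tensor M N, W)) :
  'Hom(btens_car M N, W) := (g \o linfun vsval)%VF.

Lemma bfactorE M N (W : vectType k) (g : 'Hom(tensor M N, W)) X :
  (forall a x y, g (tens (ract a x) y) = g (tens x (lact a y))) ->
  bfactor g (bcls M N X) = g X.
Proof.
move=> gb; apply/eqP; rewrite comp_lfunE lfunE -subr_eq0 -linearB /=.
have: vsval (bcls M N X) - X \in bal M N.
  by rewrite -bcls_eq0 linearB /= bcls_val subrr.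
case/memv_sumP => Y Yb ->; rewrite linear_sum big1 //= => s _.
have /memv_imgP[Z _ ->] := Yb s isT.
rewrite -(comp_lfunE g (bal_map M N (bvec s))).
suff -> : (g \o bal_map M N (bvec s))%VF = 0 by rewrite zero_lfunE.
apply: tensor_ext => x y.
by rewrite comp_lfunE bal_mapE linearB /= gb subrr zero_lfunE.
Qed.

Definition btens_lact M N (a : Lam) : 'End(btens_car M N) :=
  bfactor (bcls M N \o tmap (lact a) \1)%VF.
Definition btens_ract M N (a : Lam) : 'End(btens_car M N) :=
  bfactor (bcls M N \o tmap \1 (ract a))%VF.

Lemma btens_lactE M N a (x : M) (y : N) :
  btens_lact M N a (btens x y) = btens (lact a x) y.
Proof.
rewrite /btens_lact bfactorE => [|b z t].
  by rewrite (comp_lfunE (bcls M N)) tmap_tens id_lfunE.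
by rewrite !(comp_lfunE (bcls M N)) !tmap_tens !id_lfunE lractC; exact: btens_balanced.
Qed.

Lemma btens_ractE M N a (x : M) (y : N) :
  btens_ract M N a (btens x y) = btens x (ract a y).
Proof.
rewrite /btens_ract bfactorE => [|b z t].
  by rewrite (comp_lfunE (bcls M N)) tmap_tens id_lfunE.
by rewrite !(comp_lfunE (bcls M N)) !tmap_tens !id_lfunE -lractC; exact: btens_balanced.
Qed.

Lemma btens_ext M N (W : vectType k) (g h : 'Hom(btens_car M N, W)) :
  (forall x y, g (btens x y) = h (btens x y)) -> g = h.
Proof.
move=> gh; apply/lfunP => Z; rewrite -(bcls_val Z) -2!(comp_lfunE _ (bcls M N)).
congr (fun_of_lfun _ _); apply: tensor_ext => x y.
by rewrite 2!(comp_lfunE _ (bcls M N)); exact: gh.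
Qed.

Lemma btens_linearl M N (y : N) : linear (fun x : M => btens x y).
Proof. by move=> c x x'; rewrite /btens tens_linearl linearP. Qed.

Lemma btens_linearr M N (x : M) : linear (fun y : N => btens x y).
Proof. by move=> c y y'; rewrite /btens tens_linearr linearP. Qed.

Program Definition btensor M N : bimod Lam :=
  @Bimod k Lam (btens_car M N) (@btens_lact M N) (@btens_ract M N) _ _ _ _ _ _ _.
Next Obligation.
move=> c a b; apply: btens_ext => x y.
rewrite add_lfunE scale_lfunE !btens_lactE lact_linear.
by rewrite add_lfunE scale_lfunE btens_linearl.
Qed.
Next Obligation.
move=> c a b; apply: btens_ext => x y.
rewrite add_lfunE scale_lfunE !btens_ractE ract_linear.
by rewrite add_lfunE scale_lfunE btens_linearr.
Qed.
Next Obligation.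
move: M N x => M N Z; rewrite -[RHS]id_lfunE; congr (fun_of_lfun _ _).
by apply: btens_ext => x y; rewrite btens_lactE lact1 id_lfunE.
Qed.
Next Obligation.
move: M N x => M N Z; rewrite -[RHS]id_lfunE; congr (fun_of_lfun _ _).
by apply: btens_ext => x y; rewrite btens_ractE ract1 id_lfunE.
Qed.
Next Obligation.
move: M N a b x => M N a b Z; rewrite -(comp_lfunE (btens_lact M N a)).
congr (fun_of_lfun _ _); apply: btens_ext => x y.
by rewrite (comp_lfunE (btens_lact M N a)) !btens_lactE lactM.
Qed.
Next Obligation.
move: M N a b x => M N a b Z; rewrite -(comp_lfunE (btens_ract M N b)).
congr (fun_of_lfun _ _); apply: btens_ext => x y.
by rewrite (comp_lfunE (btens_ract M N b)) !btens_ractE ractM.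
Qed.
Next Obligation.
move: M N a b x => M N a b Z; rewrite -(comp_lfunE (btens_lact M N a)) -(comp_lfunE (btens_ract M N b)).
congr (fun_of_lfun _ _); apply: btens_ext => x y.
rewrite (comp_lfunE (btens_lact M N a)) (comp_lfunE (btens_ract M N b)).
by rewrite btens_lactE !btens_ractE btens_lactE.
Qed.

(* For a [Lam^e]-map [g] these are the maps [x \otimes y |-> g(x) y] and
   [x \otimes y |-> x g(y)], see [evlE] and [evrE]. *)
Definition evl_fun M N (g : 'Hom(M, regular_bimod)) (X : tensor M N) : N :=
  \sum_s \sum_t (X : 'M_(_, _)) s t *: lact (g (bvec s)) (bvec t).
Definition evr_fun M N (g : 'Hom(N, regular_bimod)) (X : tensor M N) : M :=
  \sum_s \sum_t (X : 'M_(_, _)) s t *: ract (g (bvec t)) (bvec s).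

Lemma evl_is_linear M N g : linear (@evl_fun M N g).
Proof.
move=> c X Y; rewrite /evl_fun scaler_sumr -big_split; apply: eq_bigr => s _.
rewrite scaler_sumr -big_split; apply: eq_bigr => t _ /=.
by rewrite !mxE scalerDl scalerA.
Qed.

Lemma evr_is_linear M N g : linear (@evr_fun M N g).
Proof.
move=> c X Y; rewrite /evr_fun scaler_sumr -big_split; apply: eq_bigr => s _.
rewrite scaler_sumr -big_split; apply: eq_bigr => t _ /=.
by rewrite !mxE scalerDl scalerA.
Qed.

HB.instance Definition _ M N g :=
  GRing.isLinear.Build k (tensor M N) N *:%R (@evl_fun M N g)
    (@evl_is_linear M N g).
HB.instance Definition _ M N g :=
  GRing.isLinear.Build k (tensor M N) M *:%R (@evr_fun M N g)
    (@evr_is_linear M N g).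

Definition evl M N (g : 'Hom(M, regular_bimod)) : 'Hom(btensor M N, N) :=
  bfactor (linfun (@evl_fun M N g)).
Definition evr M N (g : 'Hom(N, regular_bimod)) : 'Hom(btensor M N, M) :=
  bfactor (linfun (@evr_fun M N g)).

Arguments evl {M N} g.
Arguments evr {M N} g.

Lemma lact_sum M (I : finType) (c : I -> k) (a : I -> Lam) (x : M) :
  lact (\sum_i c i *: a i) x = \sum_i c i *: lact (a i) x.
Proof.
rewrite (linear_comb (@lact_linear _ _ M)) sum_lfunE.
by apply: eq_bigr => i _; rewrite scale_lfunE.
Qed.

Lemma ract_sum M (I : finType) (c : I -> k) (a : I -> Lam) (x : M) :
  ract (\sum_i c i *: a i) x = \sum_i c i *: ract (a i) x.
Proof.
rewrite (linear_comb (@ract_linear _ _ M)) sum_lfunE.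
by apply: eq_bigr => i _; rewrite scale_lfunE.
Qed.

Lemma tens_coord (U V : vectType k) (u : U) (v : V) s t :
  (tens u v : 'M_(_, _)) s t = v2r u 0 s * v2r v 0 t.
Proof. by rewrite /tens mxE big_ord1 mxE. Qed.

Lemma evl_tens M N (g : 'Hom(M, regular_bimod)) (x : M) (y : N) :
  evl_fun g (tens x y) = lact (g x) y.
Proof.
rewrite [in RHS](bvecE x) linear_sum /=.
under [X in lact X]eq_bigr do rewrite linearZ.
rewrite lact_sum; apply: eq_bigr => s _.
rewrite [in RHS](bvecE y) linear_sum scaler_sumr; apply: eq_bigr => t _ /=.
by rewrite linearZ scalerA tens_coord.
Qed.

Lemma evr_tens M N (g : 'Hom(N, regular_bimod)) (x : M) (y : N) :
  evr_fun g (tens x y) = ract (g y) x.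
Proof.
rewrite [in RHS](bvecE y) linear_sum /=.
under [X in ract X]eq_bigr do rewrite linearZ.
rewrite ract_sum /evr_fun exchange_big; apply: eq_bigr => t _.
rewrite [in RHS](bvecE x) linear_sum scaler_sumr; apply: eq_bigr => s _ /=.
by rewrite linearZ scalerA tens_coord mulrC.
Qed.

Lemma evlE M N (g : 'Hom(M, regular_bimod)) (x : M) (y : N) :
  bimod_hom g -> evl g (btens x y) = lact (g x) y.
Proof.
move=> gh; rewrite /evl /btens bfactorE => [|a z t].
  by rewrite lfunE /= evl_tens.
by rewrite !lfunE /= !evl_tens (gh _ _).2 lfunE /= lactM.
Qed.

Lemma evrE M N (g : 'Hom(N, regular_bimod)) (x : M) (y : N) :
  bimod_hom g -> evr g (btens x y) = ract (g y) x.
Proof.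
move=> gh; rewrite /evr /btens bfactorE => [|a z t].
  by rewrite lfunE /= evr_tens.
by rewrite !lfunE /= !evr_tens (gh _ _).1 lfunE /= ractM.
Qed.

End BimodTheory.

Arguments regular_bimod {k Lam}.
Arguments evl {k Lam M N} g.
Arguments evr {k Lam M N} g.

(** * The bimodule complex and the associated map *)

Section KoszulComplex.
Context (k : fieldType) (Q : quiver) (Lam : falgType k).
Context (phi : {linear pathalg k Q -> Lam}) (F : resdata k Q).

Local Notation e v := (phi (vtx v)).
Local Notation ambient n := {ffun 'I_(nf F n) -> tensor Lam Lam}.

(* [x \otimes y |-> x o(f^n_i) \otimes t(f^n_i) y] on the [i]-th summand; its
   image is [\bigoplus_i Lam o(f^n_i) \otimes t(f^n_i) Lam]. *)
Definition kproj_fun n (X : ambient n) : ambient n :=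
  [ffun i : 'I_(nf F n) => tmap (amulr (e (fo F n i))) (amull (e (ft F n i))) (X i)].

Definition kact_fun n (g h : 'End(Lam)) (X : ambient n) : ambient n :=
  [ffun i : 'I_(nf F n) => tmap g h (X i)].

Lemma kproj_is_linear n : linear (@kproj_fun n).
Proof. by move=> c X Y; apply/ffunP => i; rewrite !ffunE linearP. Qed.

Lemma kact_is_linear n g h : linear (@kact_fun n g h).
Proof. by move=> c X Y; apply/ffunP => i; rewrite !ffunE linearP. Qed.

HB.instance Definition _ n := GRing.isLinear.Build k (ambient n) (ambient n)
  *:%R (@kproj_fun n) (@kproj_is_linear n).
HB.instance Definition _ n g h := GRing.isLinear.Build k (ambient n) (ambient n)
  *:%R (@kact_fun n g h) (@kact_is_linear n g h).

Definition kspace n : {vspace ambient n} := limg (linfun (@kproj_fun n)).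
Definition kcar n : vectType k := subvs_of (kspace n).

Definition klact n (a : Lam) : 'End(kcar n) :=
  linfun (vsproj (kspace n) \o @kact_fun n (amull a) \1%VF \o vsval).
Definition kract n (a : Lam) : 'End(kcar n) :=
  linfun (vsproj (kspace n) \o @kact_fun n \1%VF (amulr a) \o vsval).

Lemma kspace_stable n (g h : 'End(Lam)) (X : ambient n) :
  (forall a x : Lam, g (x * a) = g x * a) -> (forall a x : Lam, h (a * x) = a * h x) ->
  X \in kspace n -> kact_fun g h X \in kspace n.
Proof.
move=> gP hP /memv_imgP[Y _ ->].
apply/memv_imgP; exists (kact_fun g h Y); first exact: memvf.
rewrite !lfunE /=; apply/ffunP => i; rewrite !ffunE.
rewrite -(comp_lfunE (tmap g h)) -[RHS]comp_lfunE.
congr (fun_of_lfun _ _); apply: tensor_ext => x y.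
by rewrite (comp_lfunE (tmap g h)) [RHS]comp_lfunE !tmap_tens !lfunE /= gP hP.
Qed.

Lemma klact_val n a (x : kcar n) :
  vsval (klact n a x) = kact_fun (amull a) \1%VF (vsval x).
Proof.
rewrite lfunE /= vsprojK //; apply: kspace_stable (subvsP x).
  by move=> b z; rewrite !lfunE /= mulrA.
by move=> b z; rewrite !lfunE.
Qed.

Lemma kract_val n a (x : kcar n) :
  vsval (kract n a x) = kact_fun \1%VF (amulr a) (vsval x).
Proof.
rewrite lfunE /= vsprojK //; apply: kspace_stable (subvsP x).
  by move=> b z; rewrite !lfunE.
by move=> b z; rewrite !lfunE /= mulrA.
Qed.

Lemma tmap_ext (U V U' V' : vectType k) (g g' : 'Hom(U, U'))
    (h h' : 'Hom(V, V')) X :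
  g =1 g' -> h =1 h' -> tmap g h X = tmap g' h' X.
Proof. by move=> /lfunP-> /lfunP->. Qed.

Lemma tmap_id (U V : vectType k) (X : tensor U V) : tmap \1%VF \1%VF X = X.
Proof.
rewrite -[RHS]id_lfunE; congr (fun_of_lfun _ _); apply: tensor_ext => x y.
by rewrite tmap_tens !id_lfunE.
Qed.

Lemma tmap_comp (U V : vectType k) (g g' : 'End(U)) (h h' : 'End(V)) X :
  tmap g h (tmap g' h' X) = tmap (g \o g')%VF (h \o h')%VF X.
Proof.
rewrite -(comp_lfunE (tmap g h)); congr (fun_of_lfun _ _).
apply: tensor_ext => x y.
by rewrite (comp_lfunE (tmap g h)) !tmap_tens (comp_lfunE g) (comp_lfunE h).
Qed.

Lemma tmap_linearl (U V : vectType k) c (g g' : 'End(U)) (X : tensor U V) :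
  tmap (c *: g + g') \1%VF X = c *: tmap g \1%VF X + tmap g' \1%VF X.
Proof.
rewrite -(scale_lfunE c (tmap g _)) -(add_lfunE _ (tmap g' _)).
congr (fun_of_lfun _ _); apply: tensor_ext => x y.
rewrite (add_lfunE _ (tmap g' _)) (scale_lfunE c (tmap g _)) !tmap_tens.
by rewrite add_lfunE scale_lfunE tens_linearl.
Qed.

Lemma tmap_linearr (U V : vectType k) c (h h' : 'End(V)) (X : tensor U V) :
  tmap \1%VF (c *: h + h') X = c *: tmap \1%VF h X + tmap \1%VF h' X.
Proof.
rewrite -(scale_lfunE c (tmap _ h)) -(add_lfunE _ (tmap _ h')).
congr (fun_of_lfun _ _); apply: tensor_ext => x y.
rewrite (add_lfunE _ (tmap _ h')) (scale_lfunE c (tmap _ h)) !tmap_tens.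
by rewrite add_lfunE scale_lfunE tens_linearr.
Qed.

Program Definition KK n : bimod Lam :=
  @Bimod k Lam (kcar n) (klact n) (kract n) _ _ _ _ _ _ _.
Next Obligation.
move=> c a b; apply/lfunP => x; apply: subvs_inj.
rewrite add_lfunE scale_lfunE linearP /= !klact_val.
by apply/ffunP => i; rewrite !ffunE linearP tmap_linearl.
Qed.
Next Obligation.
move=> c a b; apply/lfunP => x; apply: subvs_inj.
rewrite add_lfunE scale_lfunE linearP /= !kract_val.
by apply/ffunP => i; rewrite !ffunE linearP tmap_linearr.
Qed.
Next Obligation.
apply: subvs_inj; rewrite klact_val; apply/ffunP => i; rewrite ffunE.
rewrite -[RHS]tmap_id; apply: tmap_ext => // y.
by rewrite !lfunE /= mul1r.
Qed.
Next Obligation.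
apply: subvs_inj; rewrite kract_val; apply/ffunP => i; rewrite ffunE.
rewrite -[RHS]tmap_id; apply: tmap_ext => // y.
by rewrite !lfunE /= mulr1.
Qed.
Next Obligation.
apply: subvs_inj; rewrite !klact_val; apply/ffunP => i; rewrite !ffunE tmap_comp.
by apply: tmap_ext => y; rewrite !lfunE /= ?lfunE /= ?lfunE /= ?mulrA.
Qed.
Next Obligation.
apply: subvs_inj; rewrite !kract_val; apply/ffunP => i; rewrite !ffunE tmap_comp.
by apply: tmap_ext => y; rewrite !lfunE /= ?lfunE /= ?lfunE /= ?mulrA.
Qed.
Next Obligation.
apply: subvs_inj; rewrite klact_val !kract_val klact_val.
apply/ffunP => i; rewrite !ffunE !tmap_comp.
by apply: tmap_ext => y; rewrite !comp_lfunE !id_lfunE.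
Qed.

Definition eps n (i : 'I_(nf F n)) : KK n :=
  vsproj (kspace n)
    [ffun l : 'I_(nf F n) => if l == i then tens (e (fo F n i)) (e (ft F n i)) else 0].

Lemma vtx_idem (v : vert Q) : (vtx v : pathalg k Q) * vtx v = vtx v.
Proof.
by rewrite [LHS](pa_mul_bpath k) pmul_trivl eqxx.
Qed.

Lemma eps_val n (i : 'I_(nf F n)) : monoid_morphism phi ->
  vsval (eps i) =
    [ffun l => if l == i then tens (e (fo F n i)) (e (ft F n i)) else 0].
Proof.
move=> [_ phiM]; rewrite vsprojK //; apply/memv_imgP.
exists [ffun l : 'I_(nf F n) =>
  if l == i then tens (e (fo F n i)) (e (ft F n i)) else 0]; first exact: memvf.
rewrite lfunE; apply/ffunP => l; rewrite !ffunE.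
case: eqP => [->|_]; last by rewrite linear0.
by rewrite tmap_tens !lfunE /= -!phiM !vtx_idem.
Qed.

Definition lmul (M : bimod Lam) (a : pathalg k Q) (x : M) : M := lact (phi a) x.
Definition rmul (M : bimod Lam) (x : M) (a : pathalg k Q) : M := ract (phi a) x.

(* [d 0] is the zero map [KK 0 -> 0], not the augmentation. *)
Definition is_differential (d : forall n, 'Hom(KK n, KK n.-1)) :=
  [/\ d 0%N = 0, (forall n, bimod_hom (d n)) &
      forall n (i : 'I_(nf F n)), (0 < n)%N ->
      d n (eps i) = \sum_(j < nf F n.-1)
        (\sum_(p < nf F 1) cf F p j n i 1 *: lmul (fn F 1 p) (eps j)
         + (-1) ^+ n *:
           \sum_(q < nf F 1) cf F j q n i n.-1 *: rmul (eps j) (fn F 1 q))].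

(* [Delta m v w] is the component [KK m -> KK v \otimes_Lam KK w] of the diagonal
   map, for [m = v + w]. *)
Definition is_diagonal (Delta : forall m v w, 'Hom(KK m, btensor (KK v) (KK w))) :=
  forall m v w, m = (v + w)%N ->
  bimod_hom (Delta m v w) /\
  forall r : 'I_(nf F m),
    Delta m v w (eps r) =
      \sum_(p < nf F v) \sum_(q < nf F w)
        cf F p q m r v *: btens (eps p) (eps q).

(* The degree [m] component of [d psi - (-1)^(n-1) psi d], which takes its values
   in [KK (m - n)], for [n <= m]. The sign is written [(-1)^(n+1)]. *)
Definition bracket (n : nat) (d : forall n, 'Hom(KK n, KK n.-1))
    (psi : forall m l, 'Hom(KK m, KK l)) (m : nat) : 'Hom(KK m, KK (m - n)) :=
  ((d (m - n).+1 : 'Hom(KK (m - n).+1, KK (m - n))) \o psi m (m - n).+1)%VF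
  - (-1) ^+ n.+1 *: (psi m.-1 (m - n)%N \o d m)%VF.

(* The degree [m] component of [(eta \otimes 1 - 1 \otimes eta) Delta], for
   [n <= m]: as [eta] vanishes outside degree [n], only two components of
   [Delta] contribute. *)
Definition eta_diag (n : nat) (eta : 'Hom(KK n, regular_bimod))
    (Delta : forall m v w, 'Hom(KK m, btensor (KK v) (KK w))) (m : nat) :
    'Hom(KK m, KK (m - n)) :=
  (evl eta \o Delta m n (m - n)%N)%VF
  - (-1) ^+ (n * (m - n)) *: (evr eta \o Delta m (m - n)%N n)%VF.

(* [psi m l] is the component [KK m -> KK l] for [l = m - n + 1]; its other
   values play no role. In degrees [m < n] the equation takes place in a zero
   module. *)
Definition is_associated (n : nat) (d : forall n, 'Hom(KK n, KK n.-1))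
    (Delta : forall m v w, 'Hom(KK m, btensor (KK v) (KK w)))
    (eta : 'Hom(KK n, regular_bimod)) (psi : forall m l, 'Hom(KK m, KK l)) :=
  (forall m l, (l + n = m.+1)%N -> bimod_hom (psi m l)) /\
  (forall m, (n <= m)%N -> bracket n d psi m = eta_diag eta Delta m).

End KoszulComplex.

(* Main.v *)
(* The bracket vanishes on every generator, whatever the coefficients
   [c_{i,p'}(m,r,n)]. As [d psi - (-1)^(n-1) psi d] commutes with [d] up to sign
   and equals [(eta \otimes 1 - 1 \otimes eta) Delta], it sends a generator
   [eps^m_r] to a linear combination of generators with coefficients in [k],
   because [e_j eps_q] and [eps_q e_j] are [eps_q] or [0]. In positive degrees
   [d] is injective on such combinations: if [\sum_q l_q eps_q] is a cycle, its
   component along [f^1_p eps_j] gives [\sum_q l_q c_{pj}(n,q,1) = 0] for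
   composable [p] and [j], so that [\sum_q l_q f_q = 0] and [l = 0]. Hence the
   vanishing propagates from degree [m - 1] to degree [m], and it starts at
   [m = n], where the coefficients [c(n,r,n)] and [c(n,r,0)] are Kronecker
   deltas and [f^n_i] is a cycle at [e_j].

   That [d d = 0] follows from the coassociativity of the structure constants
   on composable triples, which holds since the composable products
   [f^a_p f^b_q f^c_r] are linearly independent in [kQ]. *)
From HB Require Import structures.
Require Import Defs.
From mathcomp Require Import all_boot all_order all_algebra all_field.
From mathcomp Require Import finmap.
From mathcomp.multinomials Require Import monalg.

Set Implicit Arguments.
Unset Strict Implicit.
Unset Printing Implicit Defensive.

Import GRing.Theory.
Import VectorInternalTheory.
Local Open Scope ring_scope.

(** * The path algebra *)

Section PathAlgebraFacts.
Context (k : fieldType) (Q : quiver).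
Local Notation kQ := (pathalg k Q).
Implicit Types (x y f : kQ) (u v : vert Q) (p q r : qpath Q).

Lemma pathalg_scalerAl c x y : (c *: x) * y = c *: (x * y).
Proof. exact: (pa_mulZl c x y). Qed.

Lemma pathalg_scalerAr c x y : x * (c *: y) = c *: (x * y).
Proof. exact: (pa_mulZr c x y). Qed.

Lemma mulvtx u v : vtx u * vtx v = (u == v)%:R *: (vtx v : kQ).
Proof.
rewrite [LHS](pa_mul_bpath k) pmul_trivl; case: eqP => _ /=.
  by rewrite scale1r.
by rewrite scale0r.
Qed.

Lemma vtx_mulE u x :
  vtx u * x = \sum_(p <- msupp x)
    (if u == porig p then x@_p else 0) *: (bpath k p : kQ).
Proof.
rewrite {1}[x](bpathE x) mulr_sumr; apply: eq_bigr => p _.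
rewrite pathalg_scalerAr [X in _ *: X](pa_mul_bpath k) pmul_trivl.
by case: eqP => _; [|rewrite [LHS]scaler0 scale0r].
Qed.

Lemma mul_vtxE u x :
  x * vtx u = \sum_(p <- msupp x)
    (if u == pterm p then x@_p else 0) *: (bpath k p : kQ).
Proof.
rewrite {1}[x](bpathE x) mulr_suml; apply: eq_bigr => p _.
rewrite pathalg_scalerAl [X in _ *: X](pa_mul_bpath k) pmul_trivr.
by case: eqP => _; [|rewrite [LHS]scaler0 scale0r].
Qed.

Lemma uniform_vtxl u v f w : uniform u v f -> vtx w * f = (w == u)%:R *: f.
Proof.
move=> [_ fP]; rewrite vtx_mulE {3}[f](bpathE f) scaler_sumr.
apply: eq_big_seq => p /fP[-> _].
by case: eqP => _; [rewrite [RHS]scale1r|rewrite [LHS]scale0r [RHS]scale0r].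
Qed.

Lemma uniform_vtxr u v f w : uniform u v f -> f * vtx w = (w == v)%:R *: f.
Proof.
move=> [_ fP]; rewrite mul_vtxE {3}[f](bpathE f) scaler_sumr.
apply: eq_big_seq => p /fP[_ ->].
by case: eqP => _; [rewrite [RHS]scale1r|rewrite [LHS]scale0r [RHS]scale0r].
Qed.

Lemma bpath_sum_coef (T : Type) (s : seq T) (c : T -> k)
    (h : T -> option (qpath Q)) r :
  (\sum_(t <- s) c t *: ob (bpath k (Q:=Q)) (h t) : kQ)@_r =
  \sum_(t <- s) c t * (h t == Some r)%:R.
Proof.
rewrite raddf_sum; apply: eq_bigr => t _ /=; rewrite mcoeffZ.
case: (h t) => [p|]; last by rewrite mcoeff0.
by rewrite mcoeffU.
Qed.

Lemma exists_longest x : x != 0 ->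
  exists2 p, p \in msupp x & forall q, q \in msupp x -> (plen q <= plen p)%N.
Proof.
move=> x0; have [p0 p0x] : exists p, p \in msupp x.
  apply/fset0Pn; apply: contraNneq x0 => e.
  by rewrite [x](bpathE x) e big_seq_fset0.
have H (s : seq (qpath Q)) : p0 \in s ->
    exists2 p, p \in s & forall q, q \in s -> (plen q <= plen p)%N.
  elim: s p0 {p0x} => [//|a s IH] p0 _.
  case: s IH => [|b s] IH.
    by exists a; rewrite ?mem_head // => q; rewrite inE => /eqP->.
  have [p ps pP] := IH b (mem_head _ _).
  case: (leqP (plen a) (plen p)) => [le_ap|/ltnW le_pa].
    exists p; first by rewrite inE ps orbT.
    by move=> q; rewrite inE => /orP[/eqP->//|/pP].
  exists a; first exact: mem_head.
  move=> q; rewrite inE => /orP[/eqP->//|/pP le_qp].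
  exact: leq_trans le_qp le_pa.
exact: H.
Qed.

(* The product of a longest path of [f] and a longest path of [x] cannot
   cancel. *)
Lemma uniform_lreg u v f x :
  uniform u v f -> vtx v * x = x -> f * x = 0 -> x = 0.
Proof.
move=> [/eqP f0 fP] xv fx0; apply/eqP; apply/negP => /negP x0.
have [p pf pmax] := exists_longest f0.
have [q qx qmax] := exists_longest x0.
(* Since $e_v x = x$, a path in the support of [x] starts at [v], so the two longest paths
   compose. *)
have qv : porig q = v.
  apply/eqP; apply: contraLR qx => nqv; rewrite -mcoeff_eq0 -xv vtx_mulE.
  under eq_bigr => r _ do rewrite -[bpath k r]/(ob (bpath k (Q:=Q)) (Some r)).
  rewrite bpath_sum_coef big1 // => r _.
  case: (v =P porig r) => [vr|]; last by rewrite mul0r.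
  case: eqP => [[rq]|]; last by rewrite mulr0.
  by move: nqv; rewrite -rq -vr eqxx.
have [r rE rv] := pmulP (etrans (fP p pf).2 (esym qv)).
have : (f * x : kQ)@_r = 0 by rewrite fx0 mcoeff0.
rewrite [f * x](pa_mulw (fsubset_refl _) (fsubset_refl _)) raddf_sum /=.
under eq_bigr => p' _ do rewrite bpath_sum_coef.
(* Only one pair of supporting paths has product [r], so the coefficient of [r] in [f * x] is a
   product of two nonzero scalars. *)
have neq p' q' : p' \in msupp f -> q' \in msupp x -> pmul p' q' = Some r ->
    p' = p /\ q' = q.
  move=> p'f q'x p'q'; have e : pterm p' = porig q'.
    by move: p'q'; rewrite /pmul; case: eqP.
  have [r' ] := pmulP e; rewrite p'q' => -[<-]; rewrite rv => -[e1 e2].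
  (* Lengths add up and both [p] and [q] are longest, so the two factorisations of [r] break at the
     same place. *)
  have := congr1 size e2; rewrite !size_cat => es.
  have sz : size p.2 = size p'.2.
    apply/eqP; rewrite eqn_leq [X in _ && X](pmax _ p'f) andbT.
    rewrite -(leq_add2r (size q.2)) es leq_add2l; exact: qmax.
  move/eqP: e2; rewrite eqseq_cat // => /andP[/eqP e2 /eqP e3].
  have pp : p' = p
    by apply: val_inj; rewrite [RHS]surjective_pairing e1 e2 -surjective_pairing.
  (* The arrows of a trivial path do not determine its vertex; composability with [p'] does. *)
  have o : porig q' = porig q by rewrite -e pp (fP p pf).2 qv.
  split=> //; apply: val_inj.
  by rewrite [RHS]surjective_pairing [LHS]surjective_pairing -e3; congr (_, _).
rewrite (bigD1_seq p) ?fset_uniq //= (bigD1_seq q) ?fset_uniq //=.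
rewrite rE eqxx mulr1 big_seq_cond big1 ?addr0; last first.
  move=> q' /andP[q'x nq]; case: eqP; rewrite ?mulr0 //.
  move=> /(neq _ _ pf q'x)[_ e].
  by rewrite e eqxx in nq.
rewrite big_seq_cond big1 ?addr0 => [/eqP|p' /andP[p'f np]]; last first.
  rewrite big_seq_cond big1 // => q' /andP[q'x _].
  case: eqP; rewrite ?mulr0 // => /(neq _ _ p'f q'x)[e _].
  by rewrite e eqxx in np.
by rewrite mulf_eq0 !mcoeff_eq0 pf qx.
Qed.

End PathAlgebraFacts.

(** * Independence and coassociativity of the structure constants *)

Lemma sum_delta (k : fieldType) (V : lmodType k) n i (x : nat -> V) :
  (i < n)%N -> \sum_(p < n) (p == i :> nat)%:R *: x p = x i.
Proof.
move=> lt_i; rewrite (bigD1 (Ordinal lt_i)) //= eqxx scale1r.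
rewrite big1 ?addr0 // => p ne_p.
by have /negPf-> : (p : nat) != i := ne_p; rewrite scale0r.
Qed.

Section StructureConstants.
Context (k : fieldType) (Q : quiver) (I : pathalg k Q -> Prop).
Context (F : resdata k Q) (resF : minimal_resolution I F).
Context (constF : structure_constants F).

Local Notation f := (fn F).
Local Notation c := (cf F).

Lemma vtx_mulfn n i w : (i < nf F n)%N ->
  vtx w * f n i = (w == fo F n i)%:R *: f n i.
Proof. by move=> lt_i; apply: uniform_vtxl (res_uniform resF lt_i). Qed.

Lemma fn_mulvtx n i w : (i < nf F n)%N ->
  f n i * vtx w = (w == ft F n i)%:R *: f n i.
Proof. by move=> lt_i; apply: uniform_vtxr (res_uniform resF lt_i). Qed.

Lemma fn_mul_ft n i : (i < nf F n)%N -> f n i * vtx (ft F n i) = f n i.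
Proof. by move=> lt_i; rewrite (fn_mulvtx _ lt_i) eqxx [LHS]scale1r. Qed.

Lemma fo_mul_fn n i : (i < nf F n)%N -> vtx (fo F n i) * f n i = f n i.
Proof. by move=> lt_i; rewrite (vtx_mulfn _ lt_i) eqxx [LHS]scale1r. Qed.

Lemma fn_mul0 n i m j : (i < nf F n)%N -> (j < nf F m)%N ->
  ft F n i != fo F m j -> f n i * f m j = 0.
Proof.
move=> lt_i lt_j ne.
rewrite -(fn_mul_ft lt_i) -mulrA (vtx_mulfn _ lt_j) (negPf ne).
by rewrite [X in _ * X]scale0r [LHS]mulr0.
Qed.

(** Directness of $\bigoplus_q f^n_q R$, tested on scalar multiples of the terminal idempotents, is
    linear independence, because each $f^n_q$ is nonzero. *)
Lemma fn_free n (l : nat -> k) : \sum_(q < nf F n) l q *: f n q = 0 ->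
  forall q, (q < nf F n)%N -> l q = 0.
Proof.
move=> sum0 q lt_q.
have := @res_direct _ _ _ _ resF n (fun q => l q *: vtx (ft F n q)).
have -> : \sum_(i < nf F n) f n i * (l i *: vtx (ft F n i)) = 0.
  rewrite -[RHS]sum0; apply: eq_bigr => i _.
  by rewrite pathalg_scalerAr (fn_mul_ft (ltn_ord i)).
move=> /(_ erefl q lt_q); rewrite pathalg_scalerAr (fn_mul_ft lt_q).
move=> /eqP; rewrite scaler_eq0 => /orP[/eqP //|/eqP fq0].
by have [] := res_uniform resF lt_q.
Qed.

(** Directness kills each $f^n_p x_p$, and a uniform element can be cancelled on the left at its
    terminus. *)
Lemma fn_direct n (x : nat -> pathalg k Q) :
  \sum_(p < nf F n) f n p * x p = 0 ->
  forall p, (p < nf F n)%N -> vtx (ft F n p) * x p = 0.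
Proof.
move=> /(res_direct resF) fx0 p lt_p.
apply: (uniform_lreg (res_uniform resF lt_p)).
  by rewrite mulrA mulvtx eqxx [X in X * _]scale1r.
by rewrite mulrA (fn_mul_ft lt_p) fx0.
Qed.

(** [fn_direct] peels off the first factor and [fn_free] treats the second. The idempotent left
    behind erases the noncomposable terms, which the indicator in the new coefficients records. *)
Lemma fn2_free n m (l : nat -> nat -> k) :
  \sum_(p < nf F n) \sum_(q < nf F m) l p q *: (f n p * f m q) = 0 ->
  forall p q, (p < nf F n)%N -> (q < nf F m)%N -> ft F n p = fo F m q ->
  l p q = 0.
Proof.
move=> sum0 p q lt_p lt_q pq.
have := @fn_direct n (fun p => \sum_(q < nf F m) l p q *: f m q).
have -> : \sum_(p < nf F n) f n p * (\sum_(q < nf F m) l p q *: f m q) = 0.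
  rewrite -[RHS]sum0; apply: eq_bigr => p' _; rewrite mulr_sumr.
  by apply: eq_bigr => q' _; rewrite pathalg_scalerAr.
move=> /(_ erefl p lt_p); rewrite mulr_sumr => sum0'.
have := @fn_free m (fun q => l p q * (ft F n p == fo F m q)%:R).
rewrite /= => /(_ _ q lt_q); rewrite pq eqxx mulr1; apply.
rewrite -[RHS]sum0'; apply: eq_bigr => q' _.
by rewrite pathalg_scalerAr (vtx_mulfn _ (ltn_ord q')) [RHS]scalerA pq.
Qed.

Lemma fn3_free n m s (l : nat -> nat -> nat -> k) :
  \sum_(p < nf F n) \sum_(q < nf F m) \sum_(r < nf F s)
    l p q r *: (f n p * (f m q * f s r)) = 0 ->
  forall p q r, (p < nf F n)%N -> (q < nf F m)%N -> (r < nf F s)%N ->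
  ft F n p = fo F m q -> ft F m q = fo F s r -> l p q r = 0.
Proof.
move=> sum0 p q r lt_p lt_q lt_r pq qr.
have := @fn_direct n (fun p => \sum_(q < nf F m) \sum_(r < nf F s)
  l p q r *: (f m q * f s r)).
rewrite /= => /(_ _ p lt_p) sum0'.
have {}sum0' : vtx (ft F n p) * (\sum_(q < nf F m) \sum_(r < nf F s)
    l p q r *: (f m q * f s r)) = 0.
  apply: sum0'; rewrite -[RHS]sum0; apply: eq_bigr => p' _; rewrite mulr_sumr.
  apply: eq_bigr => q' _; rewrite mulr_sumr.
  by apply: eq_bigr => r' _; rewrite pathalg_scalerAr.
have := @fn2_free m s (fun q r => l p q r * (ft F n p == fo F m q)%:R).
rewrite /= => /(_ _ q r lt_q lt_r qr); rewrite pq eqxx mulr1; apply.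
rewrite -[RHS]sum0' mulr_sumr; apply: eq_bigr => q' _.
rewrite mulr_sumr; apply: eq_bigr => r' _.
by rewrite pathalg_scalerAr mulrA (vtx_mulfn _ (ltn_ord q')) pathalg_scalerAl
  [RHS]scalerA pq.
Qed.

Lemma fn_expand n m i : (i < nf F (n + m))%N ->
  f (n + m) i = \sum_(p < nf F n) \sum_(q < nf F m)
    c p q (n + m) i n *: (f n p * f m q).
Proof. by move=> lt_i; rewrite (constF lt_i (leq_addr m n)) addKn. Qed.

(** Both sides are the coefficient of $f^n_p f^m_q f^s_r$ in an expansion of the same $f^{n+m+s}_i$,
    split first after degree $n+m$ or first after degree $n$; [fn3_free] compares them. *)
Lemma cf_coassoc n m s i p q r : (i < nf F (n + m + s))%N ->
  (p < nf F n)%N -> (q < nf F m)%N -> (r < nf F s)%N ->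
  ft F n p = fo F m q -> ft F m q = fo F s r ->
  \sum_(j < nf F (n + m)) c j r (n + m + s) i (n + m) * c p q (n + m) j n =
  \sum_(j < nf F (m + s)) c p j (n + m + s) i n * c q r (m + s) j m.
Proof.
move=> lt_i lt_p lt_q lt_r pq qr; apply/eqP; rewrite -subr_eq0; apply/eqP.
pose l p q r :=
  \sum_(j < nf F (n + m)) c j r (n + m + s) i (n + m) * c p q (n + m) j n -
  \sum_(j < nf F (m + s)) c p j (n + m + s) i n * c q r (m + s) j m.
apply: (@fn3_free n m s l) => //.
under eq_bigr => p' _ do under eq_bigr => q' _ do under eq_bigr => r' _ do
  rewrite scalerBl.
under eq_bigr => p' _ do under eq_bigr => q' _ do rewrite sumrB.
under eq_bigr => p' _ do rewrite sumrB.
rewrite sumrB; apply/eqP; rewrite subr_eq0; apply/eqP.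
transitivity (f (n + m + s) i).
  rewrite (fn_expand lt_i) exchange_big /=.
  under eq_bigr => q' _ do rewrite exchange_big /=.
  rewrite exchange_big /= [RHS]exchange_big /=; apply: eq_bigr => r' _.
  rewrite exchange_big /=.
  under [RHS]eq_bigr => j _ do
    rewrite (fn_expand (ltn_ord j)) mulr_suml scaler_sumr.
  rewrite [RHS]exchange_big; apply: eq_bigr => p' _ /=.
  under [RHS]eq_bigr => j _ do rewrite mulr_suml scaler_sumr.
  rewrite [RHS]exchange_big; apply: eq_bigr => q' _ /=.
  rewrite scaler_suml; apply: eq_bigr => j _.
  by rewrite pathalg_scalerAl scalerA mulrA.
rewrite (constF lt_i (_ : n <= _)%N) -addnA ?leq_addr // addKn.
apply: eq_bigr => p' _.
under eq_bigr => j _ do rewrite (fn_expand (ltn_ord j)) mulr_sumr scaler_sumr.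
rewrite exchange_big; apply: eq_bigr => q' _ /=.
under eq_bigr => j _ do rewrite mulr_sumr scaler_sumr.
rewrite exchange_big; apply: eq_bigr => r' _ /=.
rewrite scaler_suml; apply: eq_bigr => j _.
by rewrite pathalg_scalerAr scalerA.
Qed.

(** The support of a vertex is one trivial path, and uniformity ties the recorded ends [fo] and [ft]
    to it. *)
Lemma fn0_vtx i : (i < nf F 0)%N ->
  f 0 i = vtx (fo F 0 i) /\ ft F 0 i = fo F 0 i.
Proof.
move=> lt_i.
have : f 0 i \in [seq vtx v | v : vert Q].
  rewrite -(perm_mem (res_vertices resF)); apply: map_f.
  by rewrite mem_iota.
case/imageP => v _ fv; have [_ fP] := res_uniform resF lt_i.
have [] := fP (trivial_path v).
  by rewrite fv -mcoeff_neq0 mcoeffUU oner_neq0.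
by move=> <- <-; split.
Qed.

Lemma sum_fn0 : \sum_(i < nf F 0) f 0 i = 1.
Proof.
rewrite -(big_mkord xpredT (f 0)) -(big_map (f 0) xpredT id).
rewrite (perm_big _ (_ : perm_eq _ [seq vtx v | v : vert Q])) /=.
  by rewrite big_map big_enum.
by rewrite /index_iota subn0; apply: res_vertices resF.
Qed.

(** As the vertices sum to 1, $f^n_i = \sum_q f^n_i f^0_q$ is a second expansion of $f^n_i$, with
    coefficients constant in $q$; independence of composable products identifies it with the given
    one. *)
Lemma cf_unitr n i p q : (i < nf F n)%N -> (p < nf F n)%N -> (q < nf F 0)%N ->
  ft F n p = fo F 0 q -> c p q n i n = (p == i)%:R.
Proof.
move=> lt_i lt_p lt_q pq; apply/eqP; rewrite -subr_eq0; apply/eqP.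
apply: (@fn2_free n 0 (fun p q => c p q n i n - (p == i)%:R)) => //.
under eq_bigr => p' _ do under eq_bigr => q' _ do rewrite scalerBl.
under eq_bigr => p' _ do rewrite sumrB.
rewrite sumrB; apply/eqP; rewrite subr_eq0; apply/eqP.
have fE := constF lt_i (leqnn n); rewrite subnn in fE.
transitivity (f n i); first exact: esym fE.
rewrite -[LHS](sum_delta _ lt_i); apply: eq_bigr => p' _.
by rewrite -scaler_sumr -mulr_sumr sum_fn0 mulr1.
Qed.

Lemma cf_unitl n i p q : (i < nf F n)%N -> (p < nf F 0)%N -> (q < nf F n)%N ->
  ft F 0 p = fo F n q -> c p q n i 0 = (q == i)%:R.
Proof.
move=> lt_i lt_p lt_q pq; apply/eqP; rewrite -subr_eq0; apply/eqP.
apply: (@fn2_free 0 n (fun p q => c p q n i 0 - (q == i)%:R)) => //.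
under eq_bigr => p' _ do under eq_bigr => q' _ do rewrite scalerBl.
under eq_bigr => p' _ do rewrite sumrB.
rewrite sumrB; apply/eqP; rewrite subr_eq0; apply/eqP.
have fE := constF lt_i (leq0n n); rewrite subn0 in fE.
transitivity (f n i); first exact: esym fE.
rewrite exchange_big -[LHS](sum_delta _ lt_i); apply: eq_bigr => q' _.
by rewrite -scaler_sumr -mulr_suml sum_fn0 mul1r.
Qed.

Lemma fn1_arr p : (p < nf F 1)%N -> exists a, f 1 p = arr a.
Proof.
move=> lt_p; have : f 1 p \in [seq arr a | a : arrow Q].
  rewrite -(perm_mem (res_arrows resF)); apply: map_f.
  by rewrite mem_iota.
by case/imageP => a _ ->; exists a.
Qed.

Lemma fn_inj n p q : (p < nf F n)%N -> (q < nf F n)%N -> f n p = f n q -> p = q.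
Proof.
move=> lt_p lt_q fpq; apply/eqP; apply: contraTT (oner_neq0 k) => ne_pq.
rewrite negbK; apply/eqP.
(* Equal elements at distinct indices would give the nontrivial relation $f_p - f_q = 0$. *)
have := @fn_free n (fun i => (i == p)%:R - (i == q)%:R).
rewrite /= => /(_ _ p lt_p); rewrite eqxx (negPf ne_pq) subr0; apply.
under eq_bigr => i _ do rewrite scalerBl.
rewrite sumrB; apply/eqP; rewrite subr_eq0; apply/eqP.
exact: etrans (sum_delta (f n) lt_p) (etrans fpq (esym (sum_delta (f n) lt_q))).
Qed.

End StructureConstants.

(** * Functionals and generators of the bimodules [KK n] *)

Section QuotientFunctionals.
Context (k : fieldType) (Q : quiver) (Lam : falgType k).
Context (phi : {linear pathalg k Q -> Lam}) (I : pathalg k Q -> Prop).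
Context (quoLam : is_quotient phi I) (admI : admissible I).

(** An admissible ideal lies in the square of the arrow ideal, so coefficients at vertices and
    arrows depend only on the residue class. *)
Lemma ker_coef0 x p : phi x = 0 -> (plen p < 2)%N -> x@_p = 0.
Proof.
have [_ _ phi0] := quoLam; have [_ I2 _] := admI.
move=> /phi0/I2 x2 lt_p; apply/eqP; rewrite mcoeff_eq0.
by apply: contraL lt_p => /x2; rewrite -leqNgt.
Qed.

Lemma phi_vtx_neq0 v : phi (vtx v) != 0.
Proof.
apply/eqP => /ker_coef0 /(_ (isT : plen (trivial_path v) < 2)%N) /eqP.
by rewrite mcoeffUU oner_eq0.
Qed.

Lemma coef_functional p : (plen p < 2)%N ->
  exists w : 'cV[k]_(dim Lam), forall x, (v2r (phi x) *m w) 0 0 = x@_p.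
Proof.
move=> lt_p; have [_ phi_surj _] := quoLam.
(* [g] lifts the coordinate basis of [Lam]; the descended form is determined by the coefficients of
   these lifts. *)
have [g gP] : exists g : 'I_(dim Lam) -> pathalg k Q,
    forall s, phi (g s) = bvec s.
  exact: fin_all_exists (fun s => phi_surj (bvec s)).
exists (\col_s (g s)@_p) => x.
have : phi (x - \sum_s v2r (phi x) 0 s *: g s) = 0.
  rewrite linearB linear_sum /= [X in X - _](bvecE (phi x)).
  rewrite -sumrB big1 // => s _.
  by rewrite linearZ /= gP subrr.
move=> /ker_coef0 /(_ lt_p); rewrite mcoeffB => /eqP.
rewrite subr_eq0 => /eqP->.
rewrite raddf_sum !mxE; apply: eq_bigr => s _.
rewrite mxE; symmetry; exact: mcoeffZ.
Qed.

End QuotientFunctionals.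

(** * Product functionals $w_1\otimes w_2$ on a tensor product *)

Section TensorFunctional.
Context (k : fieldType) (U V : vectType k).
Context (w1 : 'cV[k]_(dim U)) (w2 : 'cV[k]_(dim V)).

Definition tens_eval (X : tensor U V) : k^o :=
  (w1^T *m (X : 'M_(_, _)) *m w2) 0 0.

Lemma tens_eval_is_linear : linear tens_eval.
Proof.
move=> a X Y; rewrite /tens_eval mulmxDr mulmxDl mxE.
by rewrite -scalemxAr -scalemxAl mxE.
Qed.

HB.instance Definition _ := GRing.isLinear.Build k (tensor U V) k^o *:%R
  tens_eval tens_eval_is_linear.

Lemma tens_evalE u v :
  tens_eval (tens u v) = (v2r u *m w1) 0 0 * (v2r v *m w2) 0 0.
Proof.
rewrite /tens_eval /tens mulmxA -trmx_mul -mulmxA mxE big_ord1.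
by rewrite mxE.
Qed.

End TensorFunctional.

(** * The generators $\varepsilon^n_i$ and maps determined by them *)

Section KoszulBimodules.
Context (k : fieldType) (Q : quiver) (Lam : falgType k).
Context (phi : {linear pathalg k Q -> Lam}) (F : resdata k Q).
Context (phiM : monoid_morphism phi).

Local Notation e v := (phi (vtx v)).
Local Notation K := (KK phi F).

Lemma lract_eps_val n (i : 'I_(nf F n)) a b :
  vsval (lact a (ract b (eps phi i)) : K n) =
  [ffun l => if l == i then tens (a * e (fo F n i)) (e (ft F n i) * b) else 0].
Proof.
rewrite klact_val kract_val eps_val //; apply/ffunP => l.
rewrite !ffunE tmap_comp.
case: eqP => [_|_]; last by rewrite linear0.
by rewrite tmap_tens !comp_lfunE !id_lfunE !lfunE.
Qed.

Lemma lact_eps_val n (i : 'I_(nf F n)) a :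
  vsval (lact a (eps phi i) : K n) =
  [ffun l => if l == i then tens (a * e (fo F n i)) (e (ft F n i)) else 0].
Proof. by rewrite -[eps phi i]ract1 lract_eps_val mulr1. Qed.

Lemma ract_eps_val n (i : 'I_(nf F n)) b :
  vsval (ract b (eps phi i) : K n) =
  [ffun l => if l == i then tens (e (fo F n i)) (e (ft F n i) * b) else 0].
Proof. by rewrite -[ract b _]lact1 lract_eps_val mul1r. Qed.

Lemma mul_e u v : e u * e v = (u == v)%:R *: e v.
Proof. by rewrite -phiM.2 mulvtx linearZ. Qed.

Lemma lact_e_eps n (i : 'I_(nf F n)) v :
  lact (e v) (eps phi i) = (v == fo F n i)%:R *: eps phi i :> K n.
Proof.
apply: subvs_inj; rewrite lact_eps_val linearZ /= eps_val //.
apply/ffunP => l; rewrite !ffunE mul_e.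
case: (l == i); last by rewrite scaler0.
have := tens_linearl (e (ft F n i)) (v == fo F n i)%:R (e (fo F n i)) 0.
rewrite addr0 => ->; rewrite -[RHS]addr0; congr (_ + _).
by rewrite /tens linear0 trmx0 mul0mx.
Qed.

Lemma ract_e_eps n (i : 'I_(nf F n)) v :
  ract (e v) (eps phi i) = (v == ft F n i)%:R *: eps phi i :> K n.
Proof.
apply: subvs_inj; rewrite ract_eps_val linearZ /= eps_val //.
apply/ffunP => l; rewrite !ffunE mul_e [ft F n i == v]eq_sym.
case: (l == i); last by rewrite scaler0.
have [->|_] := eqVneq v (ft F n i); first by rewrite !scale1r.
by rewrite !scale0r /tens linear0 mulmx0.
Qed.

(** [KK n] is the image of [kproj_fun], which sends $b_s\otimes b_t$ in the $i$-th summand to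
    $b_s\varepsilon^n_i b_t$; the coordinates of a preimage serve as coefficients. *)
Lemma eps_generate n (x : K n) : exists X : 'I_(nf F n) -> tensor Lam Lam,
  x = \sum_i \sum_s \sum_t (X i : 'M_(_, _)) s t *:
        lact (bvec s) (ract (bvec t) (eps phi i)).
Proof.
have /memv_imgP[Y _ xY] := subvsP x.
exists Y; apply: subvs_inj; rewrite xY lfunE /=.
rewrite linear_sum /=; under eq_bigr => i _ do rewrite linear_sum /=.
under eq_bigr => i _ do under eq_bigr => s _ do rewrite linear_sum /=.
under eq_bigr => i _ do under eq_bigr => s _ do under eq_bigr => t _ do
  rewrite (lract_eps_val i (bvec s) (bvec t)).
apply/ffunP => l; rewrite sum_ffunE.
under eq_bigr => i _ do rewrite sum_ffunE.
under eq_bigr => i _ do under eq_bigr => s _ do rewrite sum_ffunE.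
under eq_bigr => i _ do under eq_bigr => s _ do under eq_bigr => t _ do
  rewrite !ffunE.
rewrite (bigD1 l) //= [X in _ = _ + X]big1 ?addr0 => [|i /negPf ne]; last first.
  by rewrite big1 // => s _; rewrite big1 // => t _; rewrite eq_sym ne scaler0.
rewrite ffunE [X in tmap _ _ X]tensorE linear_sum; apply: eq_bigr => s _ /=.
rewrite linear_sum; apply: eq_bigr => t _ /=.
by rewrite linearZ /= tmap_tens eqxx !lfunE.
Qed.

Lemma bimod_hom_eps_eq n (M : bimod Lam) (g h : 'Hom(K n, M)) :
  bimod_hom g -> bimod_hom h ->
  (forall i, g (eps phi i) = h (eps phi i)) -> g = h.
Proof.
move=> gB hB gh; apply/lfunP => x; apply/eqP; rewrite -subr_eq0.
rewrite -opp_lfunE -add_lfunE -memv_ker; have [X ->] := eps_generate x.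
apply: memv_suml => i _; apply: memv_suml => s _; apply: memv_suml => t _.
apply: memvZ; rewrite memv_ker add_lfunE opp_lfunE subr_eq0.
by rewrite (gB _ _).1 (gB _ _).2 (hB _ _).1 (hB _ _).2 gh.
Qed.

Lemma bimod_hom_comp (M N P : bimod Lam) (g : 'Hom(N, P)) (h : 'Hom(M, N)) :
  bimod_hom g -> bimod_hom h -> bimod_hom (g \o h)%VF.
Proof.
move=> gB hB a x; rewrite !comp_lfunE.
by rewrite (hB a x).1 (hB a x).2 (gB a _).1 (gB a _).2.
Qed.

Lemma bimod_hom0 (M N : bimod Lam) : bimod_hom (0 : 'Hom(M, N)).
Proof. by move=> a x; rewrite !zero_lfunE !linear0. Qed.

End KoszulBimodules.

(** * The differential squares to zero *)

Section SumRearrangement.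
Context (k : fieldType) (V : lmodType k) (J L P P' : finType).

Lemma exchange_scale_sum (u : J -> P -> k) (v : J -> L -> P' -> k)
    (Z : P -> L -> P' -> V) :
  \sum_j \sum_p u j p *: (\sum_l \sum_b v j l b *: Z p l b) =
  \sum_l \sum_p \sum_b (\sum_j u j p * v j l b) *: Z p l b.
Proof.
rewrite exchange_big [RHS]exchange_big; apply: eq_bigr => p _ /=.
under eq_bigr => j _ do rewrite scaler_sumr.
rewrite exchange_big; apply: eq_bigr => l _ /=.
under eq_bigr => j _ do rewrite scaler_sumr.
rewrite exchange_big; apply: eq_bigr => b _ /=.
by rewrite scaler_suml; apply: eq_bigr => j _; rewrite scalerA.
Qed.

End SumRearrangement.

(** The shape of $d^2$ on a generator: [LL], [LR] and [RR] are the terms with two left, one left and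
    one right, and two right multiplications. The mixed terms occur twice, with opposite signs. *)
Lemma square_zero (k : fieldType) (V : lmodType k) (J L P : finType) (s s' : k)
    (x : P -> J -> k) (y : J -> P -> k)
    (x' : P -> L -> J -> k) (y' : L -> P -> J -> k)
    (LL : P -> P -> L -> V) (LR : P -> L -> P -> V) (RR : L -> P -> P -> V) :
  (forall l, \sum_p \sum_b (\sum_j x p j * x' b l j) *: LL p b l = 0) ->
  (forall l, \sum_q \sum_b (\sum_j y j q * y' l b j) *: RR l b q = 0) ->
  (forall p l q, (\sum_j x p j * y' l q j) *: LR p l q =
                 (\sum_j y j q * x' p l j) *: LR p l q) ->
  s' = - s ->
  \sum_j (\sum_p x p j *: (\sum_l (\sum_b x' b l j *: LL p b l
                              + s' *: \sum_b y' l b j *: LR p l b))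
     + s *: \sum_q y j q *: (\sum_l (\sum_b x' b l j *: LR b l q
                              + s' *: \sum_b y' l b j *: RR l b q))) = 0.
Proof.
move=> LL0 RR0 LRE s'E.
have splitX (c : k) (X Y : L -> V) :
    c *: (\sum_l (X l + s' *: Y l)) =
    c *: (\sum_l X l) + s' *: (c *: \sum_l Y l).
  by rewrite big_split scalerDr -scaler_sumr !scalerA mulrC.
under eq_bigr => j _ do under eq_bigr => p _ do rewrite splitX.
under eq_bigr => j _ do under [X in _ + _ *: X]eq_bigr => p _ do rewrite splitX.
under eq_bigr => j _ do rewrite !big_split /= -!scaler_sumr scalerDr.
rewrite !big_split /= -!scaler_sumr !exchange_scale_sum.
rewrite [X in X + _ + _]big1 // [X in _ + (_ + _ *: (_ *: X))]big1 // add0r.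
rewrite !scaler0 addr0 s'E scaleNr addrC; apply/eqP.
rewrite subr_eq0; apply/eqP.
congr (_ *: _); apply: eq_bigr => l _; rewrite exchange_big.
apply: eq_bigr => p _; apply: eq_bigr => q _.
by rewrite LRE.
Qed.

Lemma lfun_comb (k : fieldType) (U W : vectType k) (J P : finType) (s : k)
    (x y : P -> J -> k) (X Y : P -> J -> U) (g : 'Hom(U, W)) :
  g (\sum_j (\sum_p x p j *: X p j + s *: \sum_p y p j *: Y p j)) =
  \sum_j (\sum_p x p j *: g (X p j) + s *: \sum_p y p j *: g (Y p j)).
Proof.
rewrite linear_sum; apply: eq_bigr => j _; rewrite linearD linearZ /=.
by congr (_ + _ *: _); rewrite linear_sum;
  apply: eq_bigr => p _; rewrite linearZ.
Qed.

Lemma lact0 (k : fieldType) (Lam : falgType k) (M : bimod Lam) (v : M) :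
  lact 0 v = 0.
Proof.
have := @lact_linear _ _ M (-1) 0 0.
by rewrite scaler0 addr0 scaleN1r addNr => ->; rewrite zero_lfunE.
Qed.

Lemma ract0 (k : fieldType) (Lam : falgType k) (M : bimod Lam) (v : M) :
  ract 0 v = 0.
Proof.
have := @ract_linear _ _ M (-1) 0 0.
by rewrite scaler0 addr0 scaleN1r addNr => ->; rewrite zero_lfunE.
Qed.

(** * Relations and coassociativity applied to $d^2$ *)

Section Complex.
Context (k : fieldType) (Q : quiver) (Lam : falgType k).
Context (phi : {linear pathalg k Q -> Lam}) (I : pathalg k Q -> Prop).
Context (quoLam : is_quotient phi I) (admI : admissible I).
Context (F : resdata k Q) (resF : minimal_resolution I F).
Context (constF : structure_constants F).
Context (d : forall n, 'Hom(KK phi F n, KK phi F n.-1)).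
Context (dP : is_differential d).

Local Notation f := (fn F).
Local Notation c := (cf F).
Local Notation K := (KK phi F).
Local Notation eps := (eps phi).

Let phiM : monoid_morphism phi.
Proof. by case: quoLam. Qed.

Lemma phi_fn2 p : (p < nf F 2)%N -> phi (f 2 p) = 0.
Proof.
have [_ _ phi0] := quoLam; move=> lt_p; apply/phi0.
apply/(res_relations resF) => I' _; apply.
by exists p.
Qed.

Lemma lact_fn_eps0 n p (l : 'I_(nf F n)) : (p < nf F 1)%N ->
  ft F 1 p != fo F n l -> lact (phi (f 1 p)) (eps l) = 0 :> K n.
Proof.
move=> lt_p ne; rewrite -(fn_mul_ft resF lt_p) phiM.2 lactM.
by rewrite (lact_e_eps phiM) (negPf ne) scale0r linear0.
Qed.

Lemma ract_fn_eps0 n p (l : 'I_(nf F n)) : (p < nf F 1)%N ->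
  ft F n l != fo F 1 p -> ract (phi (f 1 p)) (eps l) = 0 :> K n.
Proof.
move=> lt_p ne; rewrite -(fo_mul_fn resF lt_p) phiM.2 ractM.
by rewrite (ract_e_eps phiM) eq_sym (negPf ne) scale0r linear0.
Qed.

Lemma phi_fn_mul0 p q : (p < nf F 1)%N -> (q < nf F 1)%N ->
  ft F 1 p != fo F 1 q -> phi (f 1 p) * phi (f 1 q) = 0.
Proof.
by move=> lt_p lt_q ne; rewrite -phiM.2 (fn_mul0 resF lt_p lt_q ne) linear0.
Qed.

Lemma sum_lact_phi (M : bimod Lam) (J : finType) (x : J -> k)
    (y : J -> pathalg k Q) (v : M) :
  \sum_j x j *: lact (phi (y j)) v = lact (phi (\sum_j x j *: y j)) v.
Proof.
rewrite linear_sum -lact_sum; congr (fun_of_lfun (lact _) _).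
by apply: eq_bigr => j _; rewrite [RHS]linearZ.
Qed.

Lemma sum_ract_phi (M : bimod Lam) (J : finType) (x : J -> k)
    (y : J -> pathalg k Q) (v : M) :
  \sum_j x j *: ract (phi (y j)) v = ract (phi (\sum_j x j *: y j)) v.
Proof.
rewrite linear_sum -ract_sum; congr (fun_of_lfun (ract _) _).
by apply: eq_bigr => j _; rewrite [RHS]linearZ.
Qed.

(* The products [f^1_a f^1_b], combined with the coefficients of [f^2_p], are
   relations of [Lam]. *)
Lemma sum_lact_fn2 (M : bimod Lam) (x : nat -> k) (v : M) :
  \sum_(a < nf F 1) \sum_(b < nf F 1)
    (\sum_(p < nf F 2) x p * c a b 2 p 1) *: lact (phi (f 1 a * f 1 b)) v = 0.
Proof.
rewrite pair_bigA /=.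
under eq_bigr => ab _ do rewrite scaler_suml.
rewrite exchange_big big1 // => p _ /=.
under eq_bigr => ab _ do rewrite -scalerA.
rewrite -scaler_sumr sum_lact_phi -(pair_bigA _ (fun a b : 'I_(nf F 1) =>
  c a b 2 p 1 *: (f 1 a * f 1 b))) /=.
have := fn_expand constF (n := 1) (m := 1) (ltn_ord p).
move=> <-; rewrite (phi_fn2 (ltn_ord p)).
by rewrite lact0 scaler0.
Qed.

Lemma sum_ract_fn2 (M : bimod Lam) (x : nat -> k) (v : M) :
  \sum_(b < nf F 1) \sum_(a < nf F 1)
    (\sum_(p < nf F 2) x p * c a b 2 p 1) *: ract (phi (f 1 a * f 1 b)) v = 0.
Proof.
rewrite exchange_big pair_bigA /=.
under eq_bigr => ab _ do rewrite scaler_suml.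
rewrite exchange_big big1 // => p _ /=.
under eq_bigr => ab _ do rewrite -scalerA.
rewrite -scaler_sumr sum_ract_phi -(pair_bigA _ (fun a b : 'I_(nf F 1) =>
  c a b 2 p 1 *: (f 1 a * f 1 b))) /=.
have := fn_expand constF (n := 1) (m := 1) (ltn_ord p).
move=> <-; rewrite (phi_fn2 (ltn_ord p)).
by rewrite ract0 scaler0.
Qed.

(** The degrees met in $d^2$ equal the required sums only propositionally; this form transports
    along the equalities. *)
Lemma cf_coassoc_eq u v N n m s i p q r : u = (n + m)%N -> v = (m + s)%N ->
  N = (n + m + s)%N -> (i < nf F N)%N ->
  (p < nf F n)%N -> (q < nf F m)%N -> (r < nf F s)%N ->
  ft F n p = fo F m q -> ft F m q = fo F s r ->
  \sum_(j < nf F u) c j r N i u * c p q u j n =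
  \sum_(j < nf F v) c p j N i n * c q r v j m.
Proof. by move=> -> -> ->; exact: (cf_coassoc resF constF). Qed.

Lemma diff_eps n (i : 'I_(nf F n.+1)) :
  d n.+1 (eps i) = \sum_(j < nf F n)
    (\sum_(p < nf F 1) c p j n.+1 i 1 *: lact (phi (f 1 p)) (eps j)
     + (-1) ^+ n.+1 *:
       \sum_(q < nf F 1) c j q n.+1 i n *: ract (phi (f 1 q)) (eps j)).
Proof. by have [_ _ dE] := dP; exact: dE. Qed.

Lemma diff_sq_eps n (i : 'I_(nf F n.+2)) : d n.+1 (d n.+2 (eps i)) = 0.
Proof.
have [_ dB _] := dP.
rewrite diff_eps lfun_comb.
under eq_bigr => j _.
  under eq_bigr => p _ do rewrite (dB _ _ _).1 diff_eps lfun_comb.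
  under [X in _ + _ *: X]eq_bigr => q _.
    rewrite (dB _ _ _).2 diff_eps lfun_comb.
    (* Mixed terms are put in the common form with the left action outside. *)
    under eq_bigr => l _ do under eq_bigr => b _ do rewrite -lractC.
    over.
  over.
apply: (square_zero
  (x := fun (p : 'I_(nf F 1)) (j : 'I_(nf F n.+1)) => c p j n.+2 i 1)
  (y := fun (j : 'I_(nf F n.+1)) (q : 'I_(nf F 1)) => c j q n.+2 i n.+1)
  (x' := fun (b : 'I_(nf F 1)) (l : 'I_(nf F n)) (j : 'I_(nf F n.+1)) =>
    c b l n.+1 j 1)
  (y' := fun (l : 'I_(nf F n)) (b : 'I_(nf F 1)) (j : 'I_(nf F n.+1)) =>
    c l b n.+1 j n)
  (LL := fun p b l => lact (phi (f 1 p)) (lact (phi (f 1 b)) (eps l)))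
  (LR := fun p l b => lact (phi (f 1 p)) (ract (phi (f 1 b)) (eps l)))
  (RR := fun l b q => ract (phi (f 1 q)) (ract (phi (f 1 b)) (eps l)))).
(* Splitting $n+2$ as $1+1+n$ trades the sum over $f^{n+1}_j$ for one over $f^2_p$, and relations
   act as zero. *)
- move=> l; rewrite -[RHS](sum_lact_fn2 (fun p => c p l n.+2 i 2) (eps l)).
  apply: eq_bigr => a _; apply: eq_bigr => b _.
  rewrite phiM.2 lactM.
  (* Coassociativity covers composable triples; for the others the bimodule element itself
     vanishes. *)
  have [bl|/(lact_fn_eps0 (ltn_ord b)) ->] := eqVneq (ft F 1 b) (fo F n l);
    last by rewrite linear0 !scaler0.
  have [ab|/(phi_fn_mul0 (ltn_ord a) (ltn_ord b)) ab0] :=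
      eqVneq (ft F 1 a) (fo F 1 b); last first.
    by rewrite -lactM ab0 lact0 !scaler0.
  congr (_ *: _); symmetry.
  exact: (@cf_coassoc_eq 2 n.+1 n.+2 1 1 n).
- move=> l; rewrite -[RHS](sum_ract_fn2 (fun p => c l p n.+2 i n) (eps l)).
  apply: eq_bigr => b _; apply: eq_bigr => a _.
  rewrite phiM.2 ractM.
  have [la|/(ract_fn_eps0 (ltn_ord a)) ->] := eqVneq (ft F n l) (fo F 1 a);
    last by rewrite linear0 !scaler0.
  have [ab|/(phi_fn_mul0 (ltn_ord a) (ltn_ord b)) ab0] :=
      eqVneq (ft F 1 a) (fo F 1 b); last first.
    by rewrite -ractM ab0 ract0 !scaler0.
  congr (_ *: _).
  by apply: (@cf_coassoc_eq n.+1 2 n.+2 n 1 1); rewrite ?addn1 ?addnS ?addn0.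
(* Splitting $n+2$ as $1+n+1$ equates the two coefficients of each mixed term. *)
- move=> p l q.
  have [lq|/(ract_fn_eps0 (ltn_ord q)) ->] := eqVneq (ft F n l) (fo F 1 q);
    last by rewrite linear0 !scaler0.
  have [pl|/(lact_fn_eps0 (ltn_ord p)) pl0] := eqVneq (ft F 1 p) (fo F n l);
    last by rewrite lractC pl0 linear0 !scaler0.
  congr (_ *: _); symmetry.
  by apply: (@cf_coassoc_eq n.+1 n.+1 n.+2 1 n 1); rewrite ?addn1 ?add1n.
by rewrite [in RHS]exprS mulN1r opprK.
Qed.

Lemma diff_sqS n (x : K n.+2) : d n.+1 (d n.+2 x) = 0.
Proof.
have [_ dB _] := dP.
rewrite -(comp_lfunE (d n.+1)) (_ : (d n.+1 \o d n.+2)%VF = 0) ?zero_lfunE //.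
apply: (bimod_hom_eps_eq phiM).
- by apply: bimod_hom_comp; apply: dB.
- exact: bimod_hom0.
by move=> i; rewrite comp_lfunE zero_lfunE diff_sq_eps.
Qed.

(** In the lowest degree this is the convention [d 0 = 0]. *)
Lemma diff_sq n (x : K n.+1) : d n (d n.+1 x) = 0.
Proof.
have [d0 _ _] := dP.
by case: n x => [|n] x; [rewrite d0 zero_lfunE | apply: diff_sqS].
Qed.

End Complex.

(** * Vanishing of the bracket *)

Lemma lfun_comb2_single (k : fieldType) (U W : vectType k) (P J : finType)
    (i : P)    (x : P -> J -> k) (X : P -> J -> U) (g : 'Hom(U, W)) :
  (forall p q, p != i -> g (X p q) = 0) ->
  g (\sum_p \sum_q x p q *: X p q) = \sum_q x i q *: g (X i q).
Proof.
move=> gX0; rewrite exchange_big linear_sum; apply: eq_bigr => q _ /=.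
rewrite linear_sum (bigD1 i) //= linearZ big1 ?addr0 // => p ne.
by rewrite linearZ /= gX0 ?scaler0.
Qed.

(** * Functionals reading one summand of [KK n] *)

Section CoordinateFunctional.
Context (k : fieldType) (Q : quiver) (Lam : falgType k).
Context (phi : {linear pathalg k Q -> Lam}) (F : resdata k Q).
Context (n : nat) (w1 w2 : 'cV[k]_(dim Lam)) (j : 'I_(nf F n)).

Definition kcoord (x : KK phi F n) : k^o := tens_eval w1 w2 (vsval x j).

Lemma kcoord_is_linear : linear kcoord.
Proof. by move=> a x y; rewrite /kcoord linearP !ffunE linearP. Qed.

HB.instance Definition _ := GRing.isLinear.Build k (KK phi F n) k^o *:%R
  kcoord kcoord_is_linear.

Hypothesis phiM : monoid_morphism phi.

Lemma kcoord_lact_eps (l : 'I_(nf F n)) a :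
  kcoord (lact a (eps phi l)) =
  (j == l)%:R * ((v2r (a * phi (vtx (fo F n j))) *m w1) 0 0 *
                 (v2r (phi (vtx (ft F n j))) *m w2) 0 0).
Proof.
rewrite /kcoord (lact_eps_val phiM) ffunE.
by case: eqP => [<-|_]; rewrite ?tens_evalE ?mul1r // linear0 mul0r.
Qed.

Lemma kcoord_ract_eps (l : 'I_(nf F n)) a :
  kcoord (ract a (eps phi l)) =
  (j == l)%:R * ((v2r (phi (vtx (fo F n j))) *m w1) 0 0 *
                 (v2r (phi (vtx (ft F n j)) * a) *m w2) 0 0).
Proof.
rewrite /kcoord (ract_eps_val phiM) ffunE.
by case: eqP => [<-|_]; rewrite ?tens_evalE ?mul1r // linear0 mul0r.
Qed.

End CoordinateFunctional.

Section Defect.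
Context (k : fieldType) (Q : quiver) (Lam : falgType k).
Context (phi : {linear pathalg k Q -> Lam}) (I : pathalg k Q -> Prop).
Context (quoLam : is_quotient phi I) (admI : admissible I).
Context (F : resdata k Q) (resF : minimal_resolution I F).
Context (constF : structure_constants F).
Context (d : forall n, 'Hom(KK phi F n, KK phi F n.-1)).
Context (dP : is_differential d).

Local Notation f := (fn F).
Local Notation c := (cf F).
Local Notation K := (KK phi F).
Local Notation eps := (eps phi).

Let phiM : monoid_morphism phi.
Proof. by case: quoLam. Qed.

(** The functional reads, in the $j$-th summand, the coefficient of $f^1_p\otimes t(f^n_j)$. Only
    left multiplication by $f^1_p$ produces it. *)
Lemma diff_coef n p (j : 'I_(nf F n)) : (p < nf F 1)%N ->
  ft F 1 p = fo F n j ->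
  exists g : 'Hom(K n, k^o),
    forall q : 'I_(nf F n.+1), g (d n.+1 (eps q)) = c p j n.+1 q 1.
Proof.
move=> lt_p pj; have [a fp] := fn1_arr resF lt_p.
(* [w1] detects the arrow $f^1_p$ in the left factor, [w2] the terminal vertex of $f^n_j$ in the
   right one. *)
have [w1 w1P] := @coef_functional _ _ _ _ _ quoLam admI (arrow_path a) isT.
have [w2 w2P] := @coef_functional _ _ _ _ _ quoLam admI
  (trivial_path (ft F n j)) isT.
have arr_coef b : (arr b : pathalg k Q)@_(arrow_path a) = (b == a)%:R.
  rewrite [LHS]mcoeffU; congr (_%:R); congr nat_of_bool.
  by apply/eqP/eqP => [/(congr1 val) []|->].
have fn1_coef p' : (p' < nf F 1)%N -> (f 1 p')@_(arrow_path a) = (p' == p)%:R.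
  move=> lt_p'; have [->|ne] := eqVneq p' p; first by rewrite fp arr_coef eqxx.
  have [b fp'] := fn1_arr resF lt_p'.
  rewrite fp' arr_coef; case: eqP => // ba; case/eqP: ne.
  exact: (fn_inj resF lt_p' lt_p (etrans fp' (etrans (congr1 _ ba) (esym fp)))).
pose g : 'Hom(K n, k^o) := linfun (kcoord w1 w2 j).
have gL (p' : 'I_(nf F 1)) (l : 'I_(nf F n)) :
    g (lact (phi (f 1 p')) (eps l)) = (l == j :> nat)%:R * (p' == p :> nat)%:R.
  rewrite lfunE /= (kcoord_lact_eps _ _ _ phiM) -phiM.2 w1P w2P mcoeffUU mulr1.
  rewrite (fn_mulvtx resF _ (ltn_ord p')) eq_sym (inj_eq val_inj).
  congr (_ * _).
  rewrite [LHS]mcoeffZ (fn1_coef _ (ltn_ord p')).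
  have [->|_] := eqVneq (p' : nat) p; last by rewrite mulr0.
  by rewrite pj eqxx mulr1.
(* Right multiplication leaves a vertex in the left factor, where the arrow has coefficient zero. *)
have gR (p' : 'I_(nf F 1)) (l : 'I_(nf F n)) :
    g (ract (phi (f 1 p')) (eps l)) = 0.
  rewrite lfunE /= (kcoord_ract_eps _ _ _ phiM) w1P mcoeffU.
  rewrite (_ : (trivial_path _ == arrow_path a) = false) ?mul0r ?mulr0 //.
  by apply/eqP => /(congr1 val).
exists g => q; rewrite (diff_eps dP) lfun_comb.
pose G (l p' : nat) : k^o := c p' l n.+1 q 1.
transitivity (\sum_(l < nf F n) (l == j :> nat)%:R *:
    (\sum_(p' < nf F 1) (p' == p :> nat)%:R *: G l p')).
  apply: eq_bigr => l _.
  have r0 : \sum_(p' < nf F 1) c l p' n.+1 q n *: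
      g (ract (phi (f 1 p')) (eps l)) = 0.
    by apply: big1 => p' _; rewrite gR; apply: scaler0.
  rewrite r0 scaler0 addr0 scaler_sumr; apply: eq_bigr => p' _.
  by rewrite gL [LHS]mulrC; apply: esym (mulrA _ _ _).
rewrite (sum_delta (fun l => \sum_(p' < nf F 1) (p' == p :> nat)%:R *: G l p')
  (ltn_ord j)).
exact: (sum_delta (G j) lt_p).
Qed.

(** Expand $\sum_q l_q f^{n+1}_q$ in the products $f^1_p f^n_j$: each composable coefficient is read
    off the vanishing differential by [diff_coef], so the sum is zero. *)
Lemma diff_free n (l : nat -> k) :
  d n.+1 (\sum_(q < nf F n.+1) l q *: eps q) = 0 ->
  forall q, (q < nf F n.+1)%N -> l q = 0.
Proof.
move=> d0; apply: (fn_free resF).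
under eq_bigr => q _ do
  rewrite (fn_expand constF (n := 1) (m := n) (ltn_ord q)) scaler_sumr.
rewrite exchange_big big1 // => p _ /=.
under eq_bigr => q _ do rewrite scaler_sumr.
rewrite exchange_big big1 // => j _ /=.
have [pj|ne] := eqVneq (ft F 1 p) (fo F n j); last first.
  by rewrite big1 // => q _; rewrite (fn_mul0 resF _ _ ne) // !scaler0.
have [g gE] := diff_coef (ltn_ord p) pj.
have : g (d n.+1 (\sum_(q < nf F n.+1) l q *: eps q)) = 0 by rewrite d0 linear0.
rewrite !linear_sum /= => g0.
have m0 : \sum_(q < nf F n.+1) l q * c p j n.+1 q 1 = 0.
  by rewrite -[RHS]g0; apply: eq_bigr => q _; rewrite !linearZ /= gE.
under eq_bigr => q _ do rewrite scalerA.
rewrite -scaler_suml m0; exact: scale0r.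
Qed.

(** * The defect of the associated map, by induction on the target degree *)

Section Associated.
Context (n : nat) (eta : 'Hom(K n, regular_bimod)) (eta_hom : bimod_hom eta).
Context (i : 'I_(nf F n)) (v : vert Q).
Context (eta_i : eta (eps i) = phi (vtx v)).
Context (eta_l : forall l : 'I_(nf F n), l != i -> eta (eps l) = 0).

(** Applying [eta] to $o\,\varepsilon_i = \varepsilon_i = \varepsilon_i\,t$ shows that $o$ and $t$
    fix the nonzero idempotent $e_v$, whereas distinct vertices are orthogonal. *)
Lemma hom_vtx_ends : fo F n i = v /\ ft F n i = v.
Proof.
have ev0 := phi_vtx_neq0 quoLam admI v.
split; apply/eqP.
  have := (eta_hom (phi (vtx (fo F n i))) (eps i)).1.
  rewrite (lact_e_eps phiM) eqxx scale1r eta_i lfunE /= (mul_e phiM).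
  by case: eqP => // _ e0; rewrite e0 scale0r eqxx in ev0.
have := (eta_hom (phi (vtx (ft F n i))) (eps i)).2.
rewrite (ract_e_eps phiM) eqxx scale1r eta_i lfunE /= (mul_e phiM) eq_sym.
by case: eqP => // _ e0; rewrite e0 scale0r eqxx in ev0.
Qed.

Context (Delta : forall m v w, 'Hom(K m, btensor (K v) (K w))).
Context (DeltaP : is_diagonal Delta).

(** The coefficient of $\varepsilon^l_q$ in $(\eta\otimes 1-1\otimes\eta)\Delta(\varepsilon^m_r)$;
    the indicators come from $e_v\varepsilon_q$ and $\varepsilon_q e_v$. *)
Definition defect_coef m l (r q : nat) : k :=
  (v == fo F l q)%:R * c i q m r n
  - (-1) ^+ (n * l) * ((v == ft F l q)%:R * c q i m r l).

Lemma eta_diag_eps m l (r : 'I_(nf F m)) : m = (n + l)%N ->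
  evl eta (Delta m n l (eps r))
  - (-1) ^+ (n * l) *: evr eta (Delta m l n (eps r))
  = \sum_(q < nf F l) defect_coef m l r q *: eps q.
Proof.
move=> mE; rewrite (DeltaP mE).2 (DeltaP (etrans mE (addnC n l))).2.
have -> : evl eta (\sum_(p < nf F n) \sum_(q < nf F l)
    c p q m r n *: btens (eps p) (eps q)) =
    \sum_(q < nf F l) ((v == fo F l q)%:R * c i q m r n) *: eps q.
  rewrite (lfun_comb2_single (i := i)) => [|p q ne].
    apply: eq_bigr => q _.
    rewrite (evlE _ _ eta_hom) eta_i (lact_e_eps phiM) scalerA.
    by rewrite mulrC.
  by rewrite (evlE _ _ eta_hom) (eta_l ne) lact0.
have -> : evr eta (\sum_(p < nf F l) \sum_(q < nf F n)
    c p q m r l *: btens (eps p) (eps q)) =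
    \sum_(q < nf F l) ((v == ft F l q)%:R * c q i m r l) *: eps q.
  rewrite exchange_big (lfun_comb2_single (i := i)) => [|p q ne].
    apply: eq_bigr => q _.
    rewrite (evrE _ _ eta_hom) eta_i (ract_e_eps phiM) scalerA.
    by rewrite mulrC.
  by rewrite (evrE _ _ eta_hom) (eta_l ne) ract0.
rewrite scaler_sumr -sumrB; apply: eq_bigr => q _.
by rewrite scalerA -scalerBl.
Qed.

Context (psi : forall m l, 'Hom(K m, K l)).
Context (psiP : is_associated d Delta eta psi).

(** This is [bracket] with the target degree [l] freed from the subtraction [m - n], which permits
    induction on [l]. *)
Definition defect m l : 'Hom(K m, K l) :=
  ((d l.+1 : 'Hom(K l.+1, K l)) \o psi m l.+1)%VF
  - (-1) ^+ n.+1 *: (psi m.-1 l \o d m)%VF.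

Lemma defectE m l x : defect m l x =
  d l.+1 (psi m l.+1 x) - (-1) ^+ n.+1 *: psi m.-1 l (d m x).
Proof. by rewrite add_lfunE opp_lfunE scale_lfunE !comp_lfunE. Qed.

Lemma defect_eps m l (r : 'I_(nf F m)) : m = (n + l)%N ->
  defect m l (eps r) = \sum_(q < nf F l) defect_coef m l r q *: eps q.
Proof.
move=> mE; have lE : l = (m - n)%N by rewrite mE addKn.
have le_nm : (n <= m)%N by rewrite mE leq_addr.
rewrite -(eta_diag_eps r mE); move: mE; rewrite {}lE => mE.
have := congr1 (fun g : 'Hom(K m, K (m - n)) => g (eps r)) (psiP.2 m le_nm).
rewrite /eta_diag add_lfunE opp_lfunE scale_lfunE !comp_lfunE.
exact: id.
Qed.

Lemma defect_hom m l : m = (l + n)%N -> bimod_hom (defect m l).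
Proof.
have [d0 dB _] := dP => mE; have [psiB _] := psiP.
have B1 : bimod_hom ((d l.+1 : 'Hom(K l.+1, K l)) \o psi m l.+1)%VF.
  by apply: bimod_hom_comp (dB l.+1) (psiB _ _ _); rewrite addSn mE.
have B2 : bimod_hom (psi m.-1 l \o d m)%VF.
  (* In degree 0, [psi m.-1 l] is not a component covered by [is_associated], but it is composed
     with [d 0 = 0]. *)
  case: m mE {B1} => [|m] mE.
    by rewrite d0 comp_lfun0r; apply: bimod_hom0.
  by apply: bimod_hom_comp (psiB _ _ _) (dB m.+1); rewrite mE.
move=> a x; rewrite !add_lfunE !opp_lfunE !scale_lfunE.
by rewrite (B1 a x).1 (B1 a x).2 (B2 a x).1 (B2 a x).2 !linearB !linearZ.
Qed.

Lemma defect_eq0 l : defect (l + n) l = 0.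
Proof.
elim: l => [|l IH]; apply: (bimod_hom_eps_eq phiM (defect_hom (erefl _))
  (@bimod_hom0 _ _ _ _)) => r; rewrite zero_lfunE.
  rewrite defect_eps ?addn0 // big1 // => q _.
  rewrite /defect_coef muln0 expr0 mul1r.
  have [_ e0] := fn0_vtx resF (ltn_ord q); have [oi ti] := hom_vtx_ends.
  rewrite e0; case: eqP => [vq|_]; last by rewrite !mul0r subrr scale0r.
  (* Because $f^n_i$ starts and ends at $v$, both structure constants equal the Kronecker delta of
     $i$ and $r$, and they cancel. *)
  rewrite (cf_unitr resF constF (ltn_ord r) (ltn_ord i) (ltn_ord q)) ?ti //.
  rewrite (cf_unitl resF constF (ltn_ord r) (ltn_ord q) (ltn_ord i)) ?oi ?e0 //.
  by rewrite subrr scale0r.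
have mE : (l.+1 + n = n + l.+1)%N by rewrite addnC.
have : d l.+1 (defect (l.+1 + n) l.+1 (eps r)) = 0.
  (* By induction the defect kills $d\varepsilon_r$; with $d^2=0$ this says $d\psi
     d\varepsilon_r=0$, so both terms of $d$ applied to the new defect vanish. *)
  have := congr1 (fun g : 'Hom(K (l + n), K l) => g (d (l + n).+1 (eps r))) IH.
  rewrite zero_lfunE defectE (diff_sq quoLam resF constF dP)
    linear0 scaler0 subr0 => dpd0.
  rewrite defectE linearB linearZ /= dpd0 scaler0 subr0.
  have dd0 := diff_sq quoLam resF constF dP (psi (l.+1 + n) l.+2 (eps r)).
  exact dd0.
rewrite (defect_eps r mE) => /diff_free l0.
by rewrite big1 // => q _; rewrite l0 ?scale0r.
Qed.

Lemma bracket_eq0 m : (n <= m)%N -> bracket n d psi m = 0.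
Proof.
(* The two maps agree by conversion; [subnK] then restores the source degree. *)
move=> le_nm; rewrite -[LHS]/(defect m (m - n)).
by move: (defect_eq0 (m - n)); rewrite subnK.
Qed.

End Associated.

End Defect.

Theorem theorem4p1 (k : fieldType) (Q : quiver) (Lam : falgType k)
    (phi : {linear pathalg k Q -> Lam}) (I : pathalg k Q -> Prop)
    (quoLam : is_quotient phi I) (admI : admissible I) (kosLam : koszul phi)
    (F : resdata k Q) (resF : minimal_resolution I F)
    (constF : structure_constants F)
    (d : forall n, 'Hom(KK phi F n, KK phi F n.-1)) (dP : is_differential d)
    (Delta : forall m v w,
       'Hom(KK phi F m, btensor (KK phi F v) (KK phi F w)))
    (DeltaP : is_diagonal Delta)
    (n : nat) (eta : 'Hom(KK phi F n, regular_bimod)) (eta_hom : bimod_hom eta)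
    (i : 'I_(nf F n)) (j : vert Q)
    (eta_i : eta (eps phi i) = phi (vtx j))
    (eta_l : forall l : 'I_(nf F n), l != i -> eta (eps phi l) = 0)
    (psi : forall m l, 'Hom(KK phi F m, KK phi F l))
    (psiP : is_associated d Delta eta psi)
    (m : nat) (le_nm : (n <= m)%N) (r : 'I_(nf F m)) :
  ((forall p : 'I_(nf F (m - n)),
      fo F (m - n) p != j /\ ft F (m - n) p != j) ->
    bracket n d psi m (eps phi r) = 0)
  /\
  ((exists p' : 'I_(nf F (m - n)),
      fo F (m - n) p' = j /\ ft F (m - n) p' = j) ->
    (forall p' : 'I_(nf F (m - n)),
      fo F (m - n) p' = j -> ft F (m - n) p' = j ->
      cf F i p' m r n = (-1) ^+ (n * (m - n)) * cf F p' i m r (m - n)) ->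
    bracket n d psi m (eps phi r) = 0).
Proof.
have b0 := bracket_eq0 quoLam admI resF constF dP eta_hom eta_i eta_l DeltaP
  psiP le_nm.
by split=> *; rewrite b0 zero_lfunE.
Qed.
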